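(* Let $M$ be a loopless matroid of rank $r+1$ on the ground set $E=\{0,\dots,n\}$ with $r\ge 1$. Let $\mathbf{a}=(a_1,\dots,a_n)$ be nonnegative integers with $\sum_{i=1}^n a_i=r$ and let $j=\max\{i\mid a_i>0\}$. If $j=1$, then $A_M(\mathbf{a})=1$. If $j>1$, then $$\begin{aligned}A_M(\mathbf{a})=&-A_M(a_1,\ldots,a_{j-3},\,a_{j-2}+1,\,a_{j-1},\,a_{j}-1,0,\ldots,0)\\&+ 2A_M(a_1,\ldots,a_{j-2},\,a_{j-1}+1,\,a_{j}-1,0,\ldots,0)\\&-\sum_{F}A_{M/F}(a_1,\ldots,a_{j-2}),\end{aligned}$$ where the first summand is understood as zero if $j=2$; the last sum appears only when $a_{j-1}=0$ (it is zero otherwise), and then it ranges over all flats $F$ of $M$ with $|F|=n-j+2$ and $\mathrm{rk}_M(F)=\sum_{i=j-1}^{n}a_i$.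
   Context: $M/F$ (on ground set $E\setminus F$) is the contraction. Matroidal mixed Eulerian numbers, for a matroid $N$ on a finite nonempty set $G$ with $|G|=m+1$: let $\mathrm{CH}(X_{\Pi_G},\mathbb{Q})=\mathbb{Q}[x_S:\emptyset\subsetneq S\subsetneq G]/(I_l+I_q)$ be the Chow ring of the $m$-dimensional permutohedral variety, where $I_q$ is generated by $x_Sx_T$ for inclusion-incomparable $S,T$ and $I_l$ by $\sum_{S\ni a}x_S-\sum_{S\ni b}x_S$ for $a,b\in G$. The degree map $\int_{X_{\Pi_G}}:\mathrm{CH}^m\to\mathbb{Q}$ is the isomorphism sending $x_{F_1}\cdots x_{F_m}$ to $1$ for every complete chain $\emptyset\subsetneq F_1\subsetneq\dots\subsetneq F_m\subsetneq G$ (for $m=0$ it is the identity of $\mathbb{Q}$). For $1\le i\le m$ and a fixed $g\in G$ (the class does not depend on $g$), $L_i=\sum_{S}c_{i,S}\,x_S$ with $c_{i,S}=\min(m+1-i,|S|)$ if $g\notin S$ and $c_{i,S}=\min(m+1-i,|S|)-(m+1-i)$ if $g\in S$. For loopless $N$ of rank $\rho\ge 1$, $[X_N]\in\mathrm{CH}^{m-\rho+1}(X_{\Pi_G},\mathbb{Q})$ is the unique class such that, for every chain $\emptyset\subsetneq F_1\subsetneq\dots\subsetneq F_{\rho-1}\subsetneq G$, $\int[X_N]x_{F_1}\cdots x_{F_{\rho-1}}$ equals $1$ if all $F_i$ are flats of $N$ and $0$ otherwise. For nonnegative integers $a_1,\dots,a_m$ summing to $\rho-1$, $A_N(a_1,\dots,a_m)=\int_{X_{\Pi_G}}[X_N]L_1^{a_1}\cdots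 L_m^{a_m}$. (For $m=0$ the argument list is empty.) *)

(* Defs.v *)
From HB Require Import structures.
From mathcomp Require Import all_boot all_order all_algebra.
From mathcomp Require Import generic_quotient ring_quotient.
From mathcomp Require Import boolp.
From mathcomp Require classical_sets.
From mathcomp Require Import mpoly.

Set Implicit Arguments.
Unset Strict Implicit.
Unset Printing Implicit Defensive.

Import GRing.Theory.
Local Open Scope ring_scope.
Local Open Scope quotient_scope.

(* A matroid whose ground set is the whole finite type G, presented by its
   rank function; M/F therefore lives on the subtype of elements not in F. *)
Record matroid (G : finType) := Matroid {
  rk : {set G} -> nat;
  rk_card : forall A : {set G}, (rk A <= #|A|)%N;
  rk_mono : forall A B : {set G}, A \subset B -> (rk A <= rk B)%N;
  rk_submod : forall A B : {set G},
    (rk (A :|: B) + rk (A :&: B) <= rk A + rk B)%N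
}.

Definition mrank (G : finType) (M : matroid G) : nat := rk M [set: G].

Definition loopless (G : finType) (M : matroid G) : bool :=
  [forall x, rk M [set x] == 1%N].

Definition flat (G : finType) (M : matroid G) (F : {set G}) : bool :=
  [forall x, (x \notin F) ==> (rk M F < rk M (x |: F))%N].

Section Contraction.
Variables (G : finType) (M : matroid G) (F : {set G}).

Definition contract_rk (A : {set {x : G | x \notin F}}) : nat :=
  (rk M ((val @: A) :|: F) - rk M F)%N.

Fact contract_rk_card A : (contract_rk A <= #|A|)%N.
Proof.
rewrite leq_subLR -(card_imset (mem A) val_inj) addnC.
apply: leq_trans (leq_trans (leq_addr _ _) (rk_submod M _ _)) _.
by rewrite leq_add2r rk_card.
Qed.

Fact contract_rk_mono (A B : {set {x : G | x \notin F}}) :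
  A \subset B -> (contract_rk A <= contract_rk B)%N.
Proof. by move=> sAB; rewrite leq_sub2r // rk_mono // setSU // imsetS. Qed.

Fact contract_rk_submod A B :
  (contract_rk (A :|: B) + contract_rk (A :&: B)
     <= contract_rk A + contract_rk B)%N.
Proof.
have geF C : (rk M F <= rk M (C :|: F))%N by rewrite rk_mono ?subsetUr.
rewrite -(leq_add2r (rk M F + rk M F)) [X in (X <= _)%N]addnACA !subnK ?geF //.
rewrite [X in (_ <= X)%N]addnACA !subnK ?geF //.
have := rk_submod M (val @: A :|: F) (val @: B :|: F).
by rewrite -setUUl -setUIl -imsetU -imsetI // => x y _ _; apply: val_inj.
Qed.

Definition contract : matroid {x : G | x \notin F} :=
  Matroid contract_rk_card contract_rk_mono contract_rk_submod.

End Contraction.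

Section ChowRing.
Variable G : finType.

Definition psubset : finType :=
  {S : {set G} | (S != set0) && (S \proper [set: G])}.

Definition xpoly : comNzRingType := {mpoly rat[#|psubset|]}.

Definition xvar (S : psubset) : xpoly := 'X_(enum_rank S).

Definition chow_gen (p : xpoly) : Prop :=
  (exists S T : psubset,
     [/\ ~~ (val S \subset val T), ~~ (val T \subset val S)
       & p = xvar S * xvar T]) \/
  (exists a b : G,
     p = \sum_(S : psubset | a \in val S) xvar S
         - \sum_(S : psubset | b \in val S) xvar S).

Definition chow_ideal : {pred xpoly} := fun p =>
  `[< exists cs : seq (xpoly * xpoly),
        (forall c, c \in cs -> chow_gen c.2) /\
        p = \sum_(c <- cs) c.1 * c.2 >].

Fact chow_gen_coef0 p : chow_gen p -> mcoeff 0%MM p = 0.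
Proof.
have x0 S : mcoeff 0%MM (xvar S) = 0.
  by rewrite /xvar mcoeffX mnm1_eq0.
have s0 a : mcoeff 0%MM (\sum_(S : psubset | a \in val S) xvar S) = 0.
  by rewrite (raddf_sum (mcoeff 0%MM)) big1 //= => S _; rewrite x0.
case=> [[S [T [_ _ ->]]]|[a [b ->]]].
  by rewrite (rmorphM (mcoeff 0%MM)) /= !x0 mulr0.
by rewrite (raddfB (mcoeff 0%MM)) /= !s0 subrr.
Qed.

Fact chow_ideal_closed : idealr_closed chow_ideal.
Proof.
split.
- by apply/asboolP; exists [::]; rewrite big_nil; split.
- apply/asboolP => -[cs [gen_cs /(congr1 (mcoeff 0%MM))]].
  rewrite (rmorph1 (mcoeff 0%MM)) (raddf_sum (mcoeff 0%MM)) big_seq big1.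
    by apply/eqP; rewrite oner_eq0.
  move=> c /gen_cs/chow_gen_coef0 c0.
  by apply: etrans (rmorphM (mcoeff 0%MM) _ _) _; rewrite /= c0 mulr0.
- move=> a u v /asboolP[cs [gen_cs ->]] /asboolP[ds [gen_ds ->]].
  apply/asboolP; exists ([seq (a * c.1, c.2) | c <- cs] ++ ds); split.
    move=> c; rewrite mem_cat => /orP[/mapP[d /gen_cs gd ->]|/gen_ds] //.
  rewrite big_cat big_map /= mulr_sumr; congr (_ + _).
  by apply: eq_bigr => c _; rewrite mulrA.
Qed.

HB.instance Definition _ := isIdealr.Build xpoly chow_ideal chow_ideal_closed.

Definition chow : comNzRingType := {ideal_quot chow_ideal}.

Definition chow_class (p : xpoly) : chow := \pi_({ideal_quot chow_ideal}) p.

Definition chow_homog (d : nat) (u : chow) : Prop :=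
  exists p : {mpoly rat[#|psubset|]}, p \is d.-homog /\ u = chow_class p.

Definition chow_const (c : rat) : chow :=
  chow_class (c%:MP : {mpoly rat[#|psubset|]}).

Definition xclass (S : psubset) : chow := chow_class (xvar S).

(* A chain of length k, listed increasingly; strict inclusion being
   transitive, comparing consecutive members is enough. *)
Definition is_chain (k : nat) (s : seq psubset) : bool :=
  (size s == k) && sorted (fun S T : psubset => val S \proper val T) s.

Definition chain_class (s : seq psubset) : chow := \prod_(S <- s) xclass S.

(* The dimension m of the permutohedral variety. *)
Definition pdim : nat := #|G|.-1.

(* The isomorphism CH^m -> Q is extended by zero to the other graded pieces;
   surjectivity follows from the value 1 on complete chains. *)
Definition is_degree_map (f : chow -> rat) : Prop :=
  [/\ forall c u v, f (chow_const c * u + v) = c * f u + f v,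
      forall d u, d <> pdim -> chow_homog d u -> f u = 0,
      forall u, chow_homog pdim u -> f u = 0 -> u = 0
    & forall s, is_chain pdim s -> f (chain_class s) = 1].

Definition chow_deg : chow -> rat :=
  classical_sets.xget (fun=> 0) is_degree_map.

(* L_i computed with respect to a base point g, where k = m + 1 - i. *)
Definition Lclass_at (g : G) (i : nat) : chow :=
  let k := (pdim.+1 - i)%N in
  chow_class (\sum_(S : psubset)
    ((minn k #|val S|)%:R - (if g \in val S then k%:R else 0) : rat)%:MP
      * xvar S).

(* The base point is an arbitrary element of G, nonempty where this is used. *)
Definition Lclass (i : nat) : chow :=
  if [pick g : G] is Some g then Lclass_at g i else 0.

Definition is_matroid_class (N : matroid G) (u : chow) : Prop :=
  chow_homog (pdim.+1 - mrank N)%N u /\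
  forall s, is_chain (mrank N).-1 s ->
    chow_deg (u * chain_class s) =
      if all (fun S : psubset => flat N (val S)) s then 1 else 0.

Definition matroid_class (N : matroid G) : chow :=
  classical_sets.xget 0 (is_matroid_class N).

(* A_N(a_1, ..., a_m); only the values of a at 1, ..., m are used. *)
Definition mixed_eulerian (N : matroid G) (a : nat -> nat) : rat :=
  chow_deg (matroid_class N * \prod_(1 <= i < pdim.+1) Lclass i ^+ a i).

End ChowRing.

(* Main.v *)
(* Instead of using Poincare duality, let the polynomial ring Q[x_S] act on Minkowski weights, i.e.
   on balanced functions on the chains of proper nonempty subsets, by intersecting with piecewise
   linear functions.  These operators commute, linear functions act by zero, and so does x_S x_T
   for incomparable S and T; hence p |-> (p . w)(empty chain) factors through the Chow ring for
   every balanced w.  For w the indicator of the complete flags of flats of a matroid N this is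
   u |-> deg([X_N] u); the free matroid gives the degree map, and [X_N] is an explicit product of
   divisors along the Higgs lifts of N, because the weight of an elementary quotient of N is the
   divisor of the difference of the rank functions on the weight of N.

   The recursion comes from L_{j-2} - 2 L_{j-1} + L_j = - sum of the x_S with |S| = n - j + 2.
   On the star of such an S, L_{j-1} vanishes, L_i restricts to the class L_i of M/S for
   i <= j - 2, and L_j restricts to the hyperplane class of M|S, whose only nonzero power is
   the one of exponent rk S - 1, of degree 1. *)

(* Both [chow_deg] and [matroid_class] are choices among the maps and classes with the required
   properties, so existence must be proved and the values pinned down. The delicate requirement is
   injectivity of the degree in top degree: monomials of chains span each graded piece, and all
   complete chains have the same class, the top power of [beta]. For [[X_N]] the pairing with the
   complementary degree is what enters the numbers, and monomials of chains determine it. The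
   correction of a piecewise linear function depends on the chain, which hides the symmetry of two
   successive operators. Near a fixed chain both functions may be changed by linear ones so that
   they vanish on it; the iterated action is then a symmetric double sum. The same computation shows
   that divisors of balanced weights are balanced. In the formula for [L_i] the parameter is
   [k = n + 1 - i], and the second difference is taken in [k]; the class with index 0 is linear,
   which explains the case [j = 2]. Powers of a hyperplane class are computed by moving its base
   point outside the largest flat already in the chain. *)
Require Import Defs.
From mathcomp Require Import all_boot all_order all_algebra.
From mathcomp Require Import boolp generic_quotient ring_quotient.
From mathcomp Require Import mpoly ssrcomplements.
From mathcomp Require Import zify ring.

Set Implicit Arguments.
Unset Strict Implicit.
Unset Printing Implicit Defensive.

Import GRing.Theory.
Local Open Scope ring_scope.

(** * Weights on chains *)

Section Weights.
Variable G : finType.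
Local Notation V := (psubset G).
Implicit Types (S T R Q : V) (s : {set V}) (w : {set V} -> rat) (phi psi : V -> rat).
Implicit Types (c : G -> rat).

(* These are the linear functions on the permutohedral fan provided that [\sum_e c e = 0]. *)
Definition linf c (A : {set G}) : rat := \sum_(e in A) c e.

Definition cmp S T := (val S \subset val T) || (val T \subset val S).

Definition chainset s := [forall S in s, forall T in s, cmp S T].

Lemma chainsetP s : reflect {in s &, forall S T, cmp S T} (chainset s).
Proof.
apply: (iffP 'forall_in_'forall_in_idP) => H; last by move=> S Ss T Ts; apply: H.
by move=> S T Ss Ts; apply: H.
Qed.

Lemma cmpC S T : cmp S T = cmp T S.
Proof. by rewrite /cmp orbC. Qed.

Lemma cmpxx S : cmp S S.
Proof. by rewrite /cmp subxx. Qed.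

Lemma chainsetS s s' : s \subset s' -> chainset s' -> chainset s.
Proof.
by move=> /subsetP ss' /chainsetP H; apply/chainsetP => S T /ss' ? /ss' ?; apply: H.
Qed.

Lemma linf_sum c (A B : {set G}) : A \subset B ->
  linf c B = linf c A + linf c (B :\: A).
Proof. by move=> sAB; rewrite /linf (big_setID A) /= (setIidPr sAB). Qed.

Lemma linf0 c : linf c set0 = 0.
Proof. by rewrite /linf big_set0. Qed.

Lemma linfT c : linf c [set: G] = \sum_e c e.
Proof. by apply: eq_bigl => e; rewrite inE. Qed.

Lemma linfD a c c' A : linf (fun e => a * c e + c' e) A = a * linf c A + linf c' A.
Proof. by rewrite /linf big_split /= mulr_sumr. Qed.

Lemma linfZ a c A : linf (fun e => a * c e) A = a * linf c A.
Proof. by rewrite /linf mulr_sumr. Qed.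

Lemma linfB c c' A : linf (fun e => c e - c' e) A = linf c A - linf c' A.
Proof. by rewrite /linf big_split /= sumrN. Qed.

Lemma linf_bigsum (I : finType) (a : I -> rat) (c : I -> G -> rat) A :
  linf (fun e => \sum_i a i * c i e) A = \sum_i a i * linf (c i) A.
Proof.
rewrite /linf exchange_big /=; apply: eq_bigr => i _; by rewrite mulr_sumr.
Qed.

Lemma linf1 g (A : {set G}) : linf (fun e => (e == g)%:R) A = (g \in A)%:R.
Proof.
rewrite /linf; have [gA|gA] := boolP (g \in A).
  rewrite (bigD1 g) //= eqxx big1 ?addr0 // => e /andP[_ /negbTE->] //.
by rewrite big1 // => e eA; case: eqP => // eg; rewrite -eg eA in gA.
Qed.

Lemma psubset_neq0 S : exists e, e \in val S.
Proof. by apply/set0Pn; case: S => ? /= /andP[]. Qed.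

Lemma psubset_neqT S : exists e, e \notin val S.
Proof.
have : val S \proper [set: G] by case: S => ? /= /andP[].
by case/properP => _ [e _ ?]; exists e.
Qed.

(** Take [a] in [S] outside the next smaller member of [s], and [b] outside [S] inside the next
    larger one. The difference of their indicators is 1 on [S]; smaller members contain neither
    point and larger ones contain both. *)
Lemma chain_separate s S : chainset s -> S \in s -> exists2 c, \sum_e c e = 0 &
  {in s, forall T, linf c (val T) = (T == S)%:R}.
Proof.
move=> /chainsetP chs Ss.
have [a aS aP] : exists2 a, a \in val S &
    {in s, forall T, val T \proper val S -> a \notin val T}.
  have [[T0 /andP[T0s T0S] T0max]|none] :=
      pselect (exists2 T, (T \in s) && (val T \proper val S) &
        forall T', (T' \in s) && (val T' \proper val S) -> #|val T'| <= #|val T|)%N.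
    case/properP: (T0S) => _ [a aS aT]; exists a => // T Ts TS.
    have := chs _ _ Ts T0s; rewrite /cmp => /orP[/subsetP sub|sub].
      by apply: contra aT => /sub.
    have := T0max T; rewrite Ts TS => /(_ isT) le.
    by have /eqP <- : val T0 == val T; rewrite ?eqEcard ?sub.
  have [a aS] := psubset_neq0 S; exists a => // T Ts TS; case: none.
  have pT : (T \in s) && (val T \proper val S) by rewrite Ts.
  case: (@arg_maxnP _ T (fun T => (T \in s) && (val T \proper val S))
                       (fun T => #|val T|) pT) => T' PT' max.
  by exists T'.
have [b bS bP] : exists2 b, b \notin val S &
    {in s, forall T, val S \proper val T -> b \in val T}.
  have [[T0 /andP[T0s T0S] T0max]|none] :=
      pselect (exists2 T, (T \in s) && (val S \proper val T) &
        forall T', (T' \in s) && (val S \proper val T') -> #|val T| <= #|val T'|)%N.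
    case/properP: (T0S) => _ [b bT bS]; exists b => // T Ts TS.
    have := chs _ _ Ts T0s; rewrite /cmp orbC => /orP[/subsetP sub|sub].
      by apply: sub.
    have := T0max T; rewrite Ts TS => /(_ isT) le.
    by have /eqP -> : val T == val T0; rewrite ?eqEcard ?sub.
  have [b bS] := psubset_neqT S; exists b => // T Ts TS; case: none.
  have pT : (T \in s) && (val S \proper val T) by rewrite Ts.
  case: (@arg_minnP _ T (fun T => (T \in s) && (val S \proper val T))
                       (fun T => #|val T|) pT) => T' PT' max.
  by exists T'.
exists (fun e => (e == a)%:R - (e == b)%:R).
  by rewrite -linfT linfB !linf1 !inE subrr.
move=> T Ts; rewrite linfB !linf1.
have [->|neTS] := eqVneq T S; first by rewrite aS (negbTE bS) subr0.
have := chs _ _ Ts Ss; rewrite /cmp !subEproper.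
have nv : val T != val S by apply: contra neTS => /eqP/val_inj->.
rewrite (negbTE nv) [val S == _]eq_sym (negbTE nv) /= => /orP[TS|ST].
  rewrite (negbTE (aP _ _ TS)) //; case: (boolP (b \in _)) => [bT|]; last by rewrite subrr.
  by case/negP: bS; move/proper_sub/subsetP: TS; apply.
by rewrite bP // (subsetP (proper_sub ST)) // subrr.
Qed.

Lemma chain_interp s phi : chainset s -> exists c,
  \sum_e c e = 0 /\ {in s, forall S, linf c (val S) = phi S}.
Proof.
move=> chs.
have : forall S, exists c, \sum_e c e = 0 /\
  {in s, forall T, linf c (val T) = ((S \in s) && (T == S))%:R}.
  move=> S; have [Ss|_] := boolP (S \in s).
    by have [c c0 cP] := chain_separate chs Ss; exists c.
  exists (fun=> 0); split; first by rewrite big1.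
  by move=> T _; rewrite /linf big1.
case/fin_all_exists => c cP; exists (fun e => \sum_S phi S * c S e); split.
  by rewrite -linfT linf_bigsum big1 // => S _; rewrite linfT (cP S).1 mulr0.
move=> T Ts; rewrite linf_bigsum (bigD1 T) //= (cP T).2 // Ts eqxx mulr1.
by rewrite big1 ?addr0 // => S nST; rewrite (cP S).2 // eq_sym (negbTE nST) andbF mulr0.
Qed.

(** A linear function that agrees with [phi] on the cone of [s]. It exists when [s] is a chain; by
    [actE] the choice is immaterial for balanced weights. *)
Definition corr s phi : G -> rat :=
  classical_sets.xget (fun=> 0)
    (fun c => \sum_e c e = 0 /\ {in s, forall S, linf c (val S) = phi S}).

Lemma corrP s phi : chainset s ->
  \sum_e corr s phi e = 0 /\ {in s, forall S, linf (corr s phi) (val S) = phi S}.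
Proof.
move=> chs; have [c cP] := chain_interp phi chs.
exact: (@classical_sets.xgetPex _ _ (fun c => \sum_e c e = 0 /\ _) (ex_intro _ c cP)).
Qed.

(* The tropical divisor of the piecewise linear function [phi] on the weight [w]: near the cone
   of the chain [s], [phi] is corrected by a linear function that agrees with it on [s]. *)
Definition act phi w s : rat :=
  \sum_R (phi R - linf (corr s phi) (val R)) * w (R |: s).

(** The sum may run over all [R]: members of [s] drop out because [c] vanishes there, and sets not
    comparable with [s] because of the first condition. Weights of mixed dimension are allowed. *)
Definition balanced w :=
  (forall s, w s != 0 -> chainset s) /\
  (forall s c, \sum_e c e = 0 -> {in s, forall S, linf c (val S) = 0} ->
     \sum_R linf c (val R) * w (R |: s) = 0).

Lemma balanced_chain w s : balanced w -> ~~ chainset s -> w s = 0.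
Proof. by move=> bw; apply: contraNeq => /(proj1 bw). Qed.

Lemma balanced_chainU w s R : balanced w -> ~~ chainset s -> w (R |: s) = 0.
Proof.
move=> bw nch; apply: balanced_chain => //; apply: contra nch.
exact/chainsetS/subsetUr.
Qed.

Lemma act_chain phi w s : balanced w -> ~~ chainset s -> act phi w s = 0.
Proof.
by move=> bw nch; rewrite /act big1 // => R _; rewrite balanced_chainU ?mulr0.
Qed.

(** Two corrections differ by a linear function that vanishes on [s], and balancing kills its
    contribution. *)
Lemma actE c phi w s : balanced w -> \sum_e c e = 0 ->
  {in s, forall S, linf c (val S) = phi S} ->
  act phi w s = \sum_R (phi R - linf c (val R)) * w (R |: s).
Proof.
move=> bw c0 cP; have [chs|nchs] := boolP (chainset s); last first.
  by rewrite act_chain // big1 // => R _; rewrite balanced_chainU ?mulr0.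
have [d0 dP] := corrP phi chs.
apply/eqP; rewrite -subr_eq0 -sumrB; apply/eqP.
rewrite -[RHS](proj2 bw s (fun e => c e - corr s phi e)).
- by apply: eq_bigr => R _; rewrite -mulrBl linfB; congr (_ * _); rewrite opprB [LHS]addrC addrA subrK.
- by rewrite -linfT linfB !linfT c0 d0 subrr.
- by move=> S Ss; rewrite linfB cP // dP // subrr.
Qed.

Lemma eq_act phi psi w : phi =1 psi -> act phi w = act psi w.
Proof. by move=> e; have -> : phi = psi by apply: funext. Qed.

Lemma act_lin c w s : balanced w -> \sum_e c e = 0 -> act (fun S => linf c (val S)) w s = 0.
Proof.
by move=> bw c0; rewrite (actE bw c0) // big1 // => R _; rewrite subrr mul0r.
Qed.

Lemma act_comb a phi psi w s : balanced w ->
  act (fun S => a * phi S + psi S) w s = a * act phi w s + act psi w s.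
Proof.
move=> bw; have [chs|nchs] := boolP (chainset s); last first.
  by rewrite !act_chain // mulr0 addr0.
have [c0 cP] := corrP phi chs; have [d0 dP] := corrP psi chs.
rewrite (actE (c := fun e => a * corr s phi e + corr s psi e) bw).
- rewrite /act mulr_sumr -big_split; apply: eq_bigr => R _ /=.
  by rewrite linfD opprD mulrA -mulrDl; congr (_ * _); rewrite mulrBr addrACA.
- by rewrite -linfT linfD !linfT c0 d0 mulr0 addr0.
- by move=> S Ss; rewrite linfD cP ?dP.
Qed.

Lemma act_eqlin c phi psi w s : balanced w -> \sum_e c e = 0 ->
  (forall S, phi S = psi S + linf c (val S)) -> act phi w s = act psi w s.
Proof.
move=> bw c0 e.
rewrite (@eq_act phi (fun S => 1 * psi S + linf c (val S))); last first.
  by move=> S; rewrite mul1r e.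
by rewrite act_comb // act_lin // mul1r addr0.
Qed.

Lemma act_wcomb a phi w w' s :
  act phi (fun s => a * w s + w' s) s = a * act phi w s + act phi w' s.
Proof.
by rewrite /act mulr_sumr -big_split; apply: eq_bigr => R _; rewrite mulrDr mulrCA.
Qed.

(** The Courant function of the ray of [S]; the variable [x_S] acts through it. *)
Definition delta S : V -> rat := fun T => (T == S)%:R.

(** Since [psi] vanishes on [s], its correction on [R |: s] is [psi R] times that of [delta R]. The
    result is symmetric in [phi] and [psi] up to exchanging [R] and [Q]. *)
Lemma act_act_sum phi psi w s : balanced w ->
  {in s, forall S, phi S = 0} -> {in s, forall S, psi S = 0} ->
  \sum_R phi R * act psi w (R |: s) =
  \sum_R \sum_Q phi R * psi Q * w (Q |: (R |: s))
  - \sum_R phi R * psi R *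
      \sum_Q linf (corr (R |: s) (delta R)) (val Q) * w (Q |: (R |: s)).
Proof.
move=> bw phi0 psi0; rewrite -sumrB; apply: eq_bigr => R _.
have [ch|nch] := boolP (chainset (R |: s)); last first.
  rewrite act_chain // !big1 ?mulr0 ?subrr // => Q _;
  by rewrite balanced_chainU ?mulr0.
have [c0 cP] := corrP (delta R) ch.
rewrite (actE (c := fun e => psi R * corr (R |: s) (delta R) e) bw).
- rewrite mulr_sumr [X in _ = _ - X]mulr_sumr -sumrB; apply: eq_bigr => Q _.
  by rewrite linfZ mulrBl mulrBr !mulrA.
- by rewrite -linfT linfZ linfT c0 mulr0.
- move=> S /[dup] SRs; rewrite linfZ cP // !inE /delta.
  case: eqP => [->|_ /= Ss]; first by rewrite mulr1.
  by rewrite mulr0 psi0.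
Qed.

Lemma act_act_sumC phi psi w s : balanced w ->
  {in s, forall S, phi S = 0} -> {in s, forall S, psi S = 0} ->
  \sum_R phi R * act psi w (R |: s) = \sum_R psi R * act phi w (R |: s).
Proof.
move=> bw phi0 psi0; rewrite !act_act_sum //; congr (_ - _).
  rewrite exchange_big; apply: eq_bigr => R _; apply: eq_bigr => Q _ /=.
  by rewrite [phi Q * _]mulrC setUCA.
by apply: eq_bigr => R _; rewrite [phi R * _]mulrC.
Qed.

(** Once [phi] is changed by a linear function to vanish on [s], the balancing sum of [act phi w]
    against [c] becomes the sum of [phi] against the action of [c], which is zero because [c] is
    linear. *)
Lemma balanced_act phi w : balanced w -> balanced (act phi w).
Proof.
move=> bw; split=> [s|s c c0 cP].
  by apply: contraNT => nch; rewrite act_chain.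
have [chs|nchs] := boolP (chainset s); last first.
  apply: big1 => R _; rewrite act_chain ?mulr0 //.
  by apply: contra nchs; apply/chainsetS/subsetUr.
have [d0 dP] := corrP phi chs.
pose phi' S := phi S - linf (corr s phi) (val S).
have e R : act phi w (R |: s) = act phi' w (R |: s).
  by apply: (act_eqlin (c := corr s phi)) => // S; rewrite /phi' subrK.
under eq_bigr do rewrite e.
rewrite act_act_sumC //; last by move=> S Ss; rewrite /phi' dP // subrr.
by rewrite big1 // => R _; rewrite act_lin ?mulr0.
Qed.

(** The outer corrections make both functions vanish on [s], and the inner actions are unchanged by
    adding linear functions. *)
Lemma act_comm phi psi w s : balanced w ->
  act phi (act psi w) s = act psi (act phi w) s.
Proof.
move=> bw; have [chs|nchs] := boolP (chainset s); last first.
  by rewrite !act_chain //; apply: balanced_act.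
have [c0 cP] := corrP phi chs; have [d0 dP] := corrP psi chs.
pose phi' S := phi S - linf (corr s phi) (val S).
pose psi' S := psi S - linf (corr s psi) (val S).
have e R : act phi w (R |: s) = act phi' w (R |: s).
  by apply: (act_eqlin (c := corr s phi)) => // S; rewrite /phi' subrK.
have e' R : act psi w (R |: s) = act psi' w (R |: s).
  by apply: (act_eqlin (c := corr s psi)) => // S; rewrite /psi' subrK.
rewrite {1}/act [RHS]/act.
under eq_bigr do rewrite e'.
under [in RHS]eq_bigr do rewrite e.
apply: act_act_sumC => // S Ss; first by rewrite /= cP // subrr.
by rewrite /psi' dP // subrr.
Qed.

Lemma act_delta S w s : balanced w -> S \notin s -> act (delta S) w s = w (S |: s).
Proof.
move=> bw Ss; rewrite (actE (c := fun=> 0) bw); last 2 first.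
- by rewrite big1.
- move=> T Ts; rewrite [LHS]big1 // /delta.
  by case: eqP => // TS; rewrite -TS Ts in Ss.
rewrite (bigD1 S) //= /delta eqxx [linf _ _]big1 // subr0 mul1r big1 ?addr0 //.
by move=> T /negbTE->; rewrite [linf _ _]big1 // subr0 mul0r.
Qed.

(** A set with both [S] and [T] as members is no chain, so [act (delta T) w] vanishes wherever [S]
    is a member. *)
Lemma act_delta2 S T w s : balanced w -> ~~ cmp S T ->
  act (delta S) (act (delta T) w) s = 0.
Proof.
move=> bw nST; have nch s' : S \in s' -> T \in s' -> w s' = 0.
  move=> Ss Ts; apply: balanced_chain => //; apply: contra nST => /chainsetP; exact.
have ST : S != T by apply: contra nST => /eqP->; rewrite cmpxx.
have actT s' : S \in s' -> act (delta T) w s' = 0.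
  move=> Ss; have [Ts|Ts] := boolP (T \in s'); last by rewrite act_delta // nch ?inE ?eqxx ?Ss ?orbT.
  by rewrite [LHS]big1 // => R _; rewrite nch ?mulr0 // !inE ?Ss ?Ts orbT.
have bw' := balanced_act (delta T) bw.
have [Ss|Ss] := boolP (S \in s); last by rewrite act_delta // actT ?inE ?eqxx.
by rewrite [LHS]big1 // => R _; rewrite actT ?mulr0 // !inE Ss orbT.
Qed.

(** The corrected function vanishes on [s], so a nonzero term needs a new [R] outside [s]: each
    divisor raises the codimension by one. *)
Lemma act_supp phi w K d : balanced w -> (forall s, w s != 0 -> (#|s| + d)%N = K) ->
  forall s, act phi w s != 0 -> (#|s| + d.+1)%N = K.
Proof.
move=> bw sw s; have [chs|nchs] := boolP (chainset s); last by rewrite act_chain ?eqxx.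
have [c0 cP] := corrP phi chs.
apply: contraNeq => neK; rewrite /act big1 // => R _.
have [Rs|Rs] := boolP (R \in s); first by rewrite cP // subrr mul0r.
apply/eqP; rewrite mulf_eq0; apply/orP; right; apply: contraNT neK => /sw <-.
by rewrite cardsU1 Rs /= add1n addnS.
Qed.

End Weights.

(** * The action of polynomials on weights *)

Section PolyAction.
Variable G : finType.
Local Notation V := (psubset G).
Local Notation N := #|psubset G|.
Local Notation P := {mpoly rat[#|psubset G|]}.
Implicit Types (S T R Q : V) (s : {set V}) (w : {set V} -> rat) (phi psi : V -> rat).
Implicit Types (p q : P) (m : 'X_{1..N}).

Definition actx (i : 'I_N) := act (delta (enum_val i)).

Definition actm m w := foldr (fun i => iter (m i) (actx i)) w (enum 'I_N).

Definition actp p w s : rat := \sum_(m <- msupp p) p@_m * actm m w s.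

Lemma balanced_iter phi k w : balanced w -> balanced (iter k (act phi) w).
Proof. by move=> bw; elim: k => //= k; apply: balanced_act. Qed.

Lemma balanced_actm m w : balanced w -> balanced (actm m w).
Proof. by move=> bw; rewrite /actm; elim: (enum _) => //= i l; apply: balanced_iter. Qed.

Lemma act_iterC phi psi k w : balanced w ->
  act phi (iter k (act psi) w) = iter k (act psi) (act phi w).
Proof.
move=> bw; elim: k => //= k <-; apply: funext => s.
by rewrite act_comm //; apply: balanced_iter.
Qed.

(** [actm] applies the variables in a fixed order, so the new factor has to be commuted past those
    in front of it. *)
Lemma actmU i m w : balanced w -> actm (U_(i) + m)%MM w = actx i (actm m w).
Proof.
move=> bw; rewrite /actm; have : i \in enum 'I_N by rewrite mem_enum.
have := enum_uniq 'I_N; elim: (enum 'I_N) => //= k l IHl /andP[kl ul].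
have bl : balanced (foldr (fun i => iter (m i) (actx i)) w l).
  by elim: (l) => //= j l'; apply: balanced_iter.
rewrite inE mnmDE mnm1E; have [->|nik /= il] := eqVneq i k.
  move=> _; rewrite add1n iterS; congr (actx k (iter _ _ _)).
  elim: l kl {ul IHl bl} => //= j l IHl; rewrite inE negb_or => /andP[kj kl].
  by rewrite mnmDE mnm1E (negbTE kj) add0n IHl.
by rewrite add0n IHl // [RHS]act_iterC.
Qed.

Lemma actpE k p w s : (msize p <= k)%N ->
  actp p w s = \sum_(m : 'X_{1..N < k}) p@_m * actm m w s.
Proof.
move=> le_pi; set I : subFinType _ := 'X_{1..N < k}.
rewrite /actp (big_mksub I) ?msupp_uniq //=; first last.
  by move=> x /msize_mdeg_lt /leq_trans; apply.
rewrite big_rmcond //= => j /memN_msupp_eq0 ->.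
by rewrite mul0r.
Qed.

Lemma actp_comb a p q w s : actp (a *: p + q) w s = a * actp p w s + actp q w s.
Proof.
pose k := maxn (maxn (msize p) (msize q)) (msize (a *: p + q)).
rewrite !(@actpE k) ?leq_max ?leqnn ?orbT // mulr_sumr -big_split.
by apply: eq_bigr => m _; rewrite mcoeffD mcoeffZ mulrDl mulrA.
Qed.

Lemma actp0 w s : actp 0 w s = 0.
Proof. by rewrite /actp msupp0 big_nil. Qed.

Lemma actpD p q w s : actp (p + q) w s = actp p w s + actp q w s.
Proof. by rewrite -[p]scale1r actp_comb mul1r scale1r. Qed.

Lemma actpZ a p w s : actp (a *: p) w s = a * actp p w s.
Proof. by rewrite -[a *: p]addr0 actp_comb actp0 addr0. Qed.

Lemma actpN p w s : actp (- p) w s = - actp p w s.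
Proof. by rewrite -scaleN1r actpZ mulN1r. Qed.

Lemma actp_sum (I : Type) (r : seq I) (B : pred I) (F : I -> P) w s :
  actp (\sum_(i <- r | B i) F i) w s = \sum_(i <- r | B i) actp (F i) w s.
Proof.
by apply: (big_morph (fun p => actp p w s)) => [p q|]; [apply: actpD | apply: actp0].
Qed.

Lemma actpX m w s : actp 'X_[m] w s = actm m w s.
Proof. by rewrite /actp msuppX big_seq1 mcoeffX eqxx mul1r. Qed.

Lemma actm0 w : actm 0%MM w = w.
Proof. by rewrite /actm; elim: (enum _) => //= i l ->; rewrite mnm0E. Qed.

Lemma actp1 w s : actp 1 w s = w s.
Proof. by rewrite -mpolyX0 actpX actm0. Qed.

Lemma act0w phi : act phi (fun=> 0) = (fun=> 0) :> ({set V} -> rat).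
Proof. by apply: funext => s; rewrite /act big1 // => R _; rewrite mulr0. Qed.

Lemma mpoly_lin_ind (K : P -> Prop) : K 0 ->
  (forall a m p, K p -> K (a *: 'X_[m] + p)) -> forall p, K p.
Proof.
move=> K0 KS p; rewrite [p]mpolyE; elim: (msupp p) => [|m l IHl].
  by rewrite big_nil.
by rewrite big_cons; apply: KS.
Qed.

Lemma balanced_actp p w : balanced w -> balanced (actp p w).
Proof.
move=> bw; elim/mpoly_lin_ind: p => [|a m p IHp].
  split=> [s|s c c0 cP]; first by rewrite actp0 eqxx.
  by rewrite big1 // => R _; rewrite actp0 mulr0.
have bm := balanced_actm m bw.
split=> [s|s c c0 cP].
  rewrite actp_comb actpX; apply: contraNT => nch.
  by rewrite !(balanced_chain _ nch) // mulr0 addr0.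
under eq_bigr do rewrite actp_comb actpX mulrDr mulrCA.
by rewrite big_split /= -mulr_sumr (proj2 bm) // (proj2 IHp) // mulr0 addr0.
Qed.

Lemma actp_Xi i p w : balanced w -> actp ('X_i * p) w = actx i (actp p w).
Proof.
move=> bw; elim/mpoly_lin_ind: p => [|a m p IHp].
  rewrite mulr0 [X in actx i X](_ : _ = fun=> 0); last by apply: funext => s; rewrite actp0.
  by rewrite /actx act0w; apply: funext => s; rewrite actp0.
rewrite mulrDr -scalerAr -mpolyXD; apply: funext => s.
rewrite actp_comb IHp actpX actmU // -act_wcomb; congr (act _ _ s).
by apply: funext => s'; rewrite actp_comb actpX.
Qed.

Lemma actp_xvar S p w : balanced w ->
  actp ((xvar S : P) * p) w = act (delta S) (actp p w).
Proof.
by move=> bw; have := actp_Xi (enum_rank S) p bw; rewrite /actx enum_rankK; apply.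
Qed.

Definition lform phi : P := \sum_S (phi S)%:MP * (xvar S : P).

Lemma act_bigsum (I : finType) (f : I -> V -> rat) (a : I -> rat) w s : balanced w ->
  act (fun S => \sum_i a i * f i S) w s = \sum_i a i * act (f i) w s.
Proof.
move=> bw; have [chs|nchs] := boolP (chainset s); last first.
  by rewrite act_chain // big1 // => i _; rewrite act_chain ?mulr0.
rewrite (actE (c := fun e => \sum_i a i * corr s (f i) e) bw).
- under [RHS]eq_bigr do rewrite mulr_sumr.
  rewrite exchange_big; apply: eq_bigr => R _ /=.
  by rewrite linf_bigsum -sumrB mulr_suml; apply: eq_bigr => i _; rewrite -mulrBr mulrA.
- rewrite -linfT linf_bigsum big1 // => i _.
  by rewrite linfT (corrP (f i) chs).1 mulr0.
- by move=> S Ss; rewrite linf_bigsum; apply: eq_bigr => i _; rewrite (corrP (f i) chs).2.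
Qed.

Lemma actp_lform phi p w : balanced w -> actp (lform phi * p) w = act phi (actp p w).
Proof.
move=> bw; apply: funext => s; rewrite /lform mulr_suml actp_sum.
rewrite (@eq_act _ phi (fun T => \sum_S phi S * delta S T)); last first.
  move=> T; rewrite (bigD1 T) //= /delta eqxx mulr1 big1 ?addr0 // => S nST.
  by rewrite eq_sym (negbTE nST) mulr0.
rewrite act_bigsum; last exact: balanced_actp.
by apply: eq_bigr => S _; rewrite -mulrA mul_mpolyC actpZ actp_xvar.
Qed.

Lemma actp_ideal q w s : balanced w -> q \in @chow_ideal G -> actp q w s = 0.
Proof.
move=> bw /asboolP[cs [gen ->]]; rewrite actp_sum big_seq big1 // => -[p g] /gen /= gg.
have bp := balanced_actp p bw.
(* The generator is put in front, so that it acts last, on the balanced weight [actp p w]. *)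
rewrite mulrC; case: gg => [[S [T [ST TS ->]]]|[a [b ->]]].
  rewrite -mulrA !actp_xvar // act_delta2 //.
  by rewrite /cmp negb_or ST.
have -> : \sum_(S : V | a \in val S) (xvar S : P) - \sum_(S : V | b \in val S) (xvar S : P)
   = lform (fun S => linf (fun e => (e == a)%:R - (e == b)%:R) (val S)).
  rewrite [X in X - _]big_mkcond [X in _ - X]big_mkcond -sumrB; apply: eq_bigr => S _.
  rewrite linfB !linf1 mul_mpolyC scalerBl.
  by congr (_ - _); case: ifP; rewrite ?scale1r ?scale0r.
rewrite actp_lform // act_lin //.
by rewrite -linfT linfB !linf1 !inE subrr.
Qed.

Lemma mnm_addU_ind (K : 'X_{1..N} -> Prop) : K 0%MM ->
  (forall i m, K m -> K (U_(i) + m)%MM) -> forall m, K m.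
Proof.
move=> K0 KS m; have [d] := ubnP (mdeg m); elim: d m => // d IHd m lemd.
have [->//|m0] := eqVneq m 0%MM.
have [i mi] : exists i, m i != 0%N.
  apply/existsP; apply: contraNT m0; rewrite negb_exists => /forallP H.
  by apply/eqP/mnmP => i; rewrite mnm0E; apply/eqP; rewrite -[_ == _]negbK H.
have em : m = (U_(i) + (m - U_(i)))%MM by rewrite addmC submK // lep1mP.
by rewrite em; apply/KS/IHd; move: lemd; rewrite {1}em mdegD mdeg1.
Qed.

Lemma actm_supp m w K : balanced w -> (forall s, w s != 0 -> #|s| = K) ->
  forall s, actm m w s != 0 -> (#|s| + mdeg m)%N = K.
Proof.
move=> bw sw; elim/mnm_addU_ind: m => [|i m IHm] s.
  by rewrite actm0 mdeg0 addn0; apply: sw.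
by rewrite actmU // mdegD mdeg1 add1n; apply: act_supp => //; apply: balanced_actm.
Qed.

Lemma actp_supp d p w K : balanced w -> (forall s, w s != 0 -> #|s| = K) ->
  p \is d.-homog -> forall s, (#|s| + d)%N != K -> actp p w s = 0.
Proof.
move=> bw sw /dhomogP hp s ne; rewrite /actp big_seq big1 // => m /hp dm.
case: (eqVneq (actm m w s) 0) => [->|/actm_supp]; first by rewrite mulr0.
by move=> /(_ K bw sw) e; rewrite -e -dm eqxx in ne.
Qed.

(** A variable whose set is not yet in the chain merely adjoins it, so the action recovers the
    weight. *)
Lemma actp_chain s w : balanced w -> chainset s ->
  actp (\prod_(S in s) (xvar S : P)) w set0 = w s.
Proof.
move=> bw chs.
suff H (l : seq V) (t : {set V}) : uniq l -> {in l, forall S, S \notin t} ->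
    actp (\prod_(S <- l) (xvar S : P)) w t = w ([set S in l] :|: t).
  rewrite -big_enum H ?enum_uniq //; last by move=> S; rewrite inE.
  by congr w; apply/setP => S; rewrite !inE mem_enum orbF.
elim: l t => [|S l IHl] t /=.
  by rewrite big_nil actp1 => _ _; congr w; apply/setP => S; rewrite !inE.
move=> /andP[Sl ul] lt; rewrite big_cons actp_xvar // act_delta; last first.
- by apply: lt; rewrite inE eqxx.
- exact: balanced_actp.
rewrite IHl //; first by congr w; apply/setP => T; rewrite !inE orbCA orbA.
move=> T Tl; rewrite !inE negb_or lt ?inE ?Tl ?orbT // andbT.
by apply: contra Sl => /eqP<-.
Qed.

End PolyAction.

(** * The Chow ring in terms of chains *)

Section ChowTheory.
Variable G : finType.
Local Notation V := (psubset G).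
Local Notation N := #|psubset G|.
Local Notation P := {mpoly rat[#|psubset G|]}.
Implicit Types (S T R Q : V) (s : {set V}) (w : {set V} -> rat) (phi psi : V -> rat).
Implicit Types (p q : P) (m : 'X_{1..N}) (u v : chow G).
Local Notation cls := (@chow_class G).

Lemma chow_classD p q : cls (p + q) = cls p + cls q.
Proof. exact: (rmorphD (\pi_({ideal_quot (@chow_ideal G)})%qT)). Qed.

Lemma chow_classM p q : cls (p * q) = cls p * cls q.
Proof. exact: (rmorphM (\pi_({ideal_quot (@chow_ideal G)})%qT)). Qed.

Lemma chow_class0 : cls 0 = 0.
Proof. exact: (rmorph0 (\pi_({ideal_quot (@chow_ideal G)})%qT)). Qed.

Lemma chow_class1 : cls 1 = 1.
Proof. exact: (rmorph1 (\pi_({ideal_quot (@chow_ideal G)})%qT)). Qed.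

Lemma chow_classN p : cls (- p) = - cls p.
Proof. exact: (rmorphN (\pi_({ideal_quot (@chow_ideal G)})%qT)). Qed.

Lemma chow_class_sum (I : Type) (r : seq I) (B : pred I) (F : I -> P) :
  cls (\sum_(i <- r | B i) F i) = \sum_(i <- r | B i) cls (F i).
Proof. exact: (big_morph _ chow_classD chow_class0). Qed.

Lemma chow_class_prod (I : Type) (r : seq I) (B : pred I) (F : I -> P) :
  cls (\prod_(i <- r | B i) F i) = \prod_(i <- r | B i) cls (F i).
Proof. exact: (big_morph _ chow_classM chow_class1). Qed.

Lemma chow_classX p k : cls (p ^+ k) = cls p ^+ k.
Proof. by elim: k => [|k IHk]; rewrite ?expr0 ?chow_class1 // !exprS chow_classM IHk. Qed.

Lemma chow_classZ a p : cls (a *: p) = chow_const G a * cls p.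
Proof. by rewrite -mul_mpolyC chow_classM. Qed.

Lemma chow_class_eq p q : cls p = cls q -> (p - q : P) \in @chow_ideal G.
Proof.
by move=> e; rewrite (@Quotient.idealrBE _ (@chow_ideal G)); apply/eqP.
Qed.

Lemma chow_ideal_eq0 p : p \in @chow_ideal G -> cls p = 0.
Proof.
move=> pI; rewrite -chow_class0; apply/eqP.
by rewrite -(@Quotient.idealrBE _ (@chow_ideal G)) subr0.
Qed.

Lemma chow_gen_eq0 p : chow_gen p -> cls p = 0.
Proof.
move=> gp; apply: chow_ideal_eq0; apply/asboolP; exists [:: (1, p)]; split.
  by move=> c; rewrite inE => /eqP->.
by rewrite big_seq1 /= mul1r.
Qed.

Lemma chow_reprK u : cls (repr u) = u.
Proof. exact: reprK. Qed.

Lemma chow_const0 : chow_const G 0 = 0.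
Proof. by rewrite /chow_const mpolyC0 chow_class0. Qed.

Lemma chow_const1 : chow_const G 1 = 1.
Proof. by rewrite /chow_const mpolyC1 chow_class1. Qed.

Lemma chow_constD a b : chow_const G (a + b) = chow_const G a + chow_const G b.
Proof. by rewrite /chow_const mpolyCD chow_classD. Qed.

Lemma chow_constM a b : chow_const G (a * b) = chow_const G a * chow_const G b.
Proof. by rewrite /chow_const mpolyCM chow_classM. Qed.

Lemma chow_constN a : chow_const G (- a) = - chow_const G a.
Proof. by rewrite /chow_const mpolyCN chow_classN. Qed.

(** * Relations in the Chow ring and spanning by monomials of chains *)

Lemma xclass_incomp S T : ~~ cmp S T -> xclass S * xclass T = 0.
Proof.
move=> nST; rewrite /xclass -chow_classM; apply: chow_gen_eq0; left.
by exists S, T; move: nST; rewrite negb_or => /andP[].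
Qed.

Lemma xclass_point a b :
  \sum_(S : V | a \in val S) xclass S = \sum_(S : V | b \in val S) xclass S.
Proof.
apply/eqP; rewrite -subr_eq0 -!chow_class_sum -chow_classN -chow_classD.
by apply/eqP/chow_gen_eq0; right; exists a, b.
Qed.

(** Regrouped by elements, the sum combines, with coefficients [c e], the sums over the [S]
    containing [e], which are all equal in the Chow ring. *)
Lemma xclass_lin (c : G -> rat) : \sum_e c e = 0 ->
  \sum_S chow_const G (linf c (val S)) * xclass S = 0.
Proof.
move=> c0.
have [g _|G0] := pickP G; last first.
  by rewrite big1 // => S _; have [e _] := psubset_neq0 S; have := G0 e.
transitivity (\sum_e chow_const G (c e) * \sum_(S : V | e \in val S) xclass S).
  under [RHS]eq_bigr do rewrite mulr_sumr.
  rewrite (exchange_big_dep predT) //=; apply: eq_bigr => S _.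
  rewrite -mulr_suml; congr (_ * _).
  by rewrite /linf (big_morph _ chow_constD chow_const0).
under eq_bigr => e _ do rewrite (xclass_point e g).
by rewrite -mulr_suml -(big_morph _ chow_constD chow_const0) c0 chow_const0 mul0r.
Qed.

(* [u] lies in the linear span of the squarefree monomials of chains of size [d]. *)
Definition chain_span d u := forall K : chow G -> Prop, K 0 ->
  (forall a v v', K v -> K v' -> K (chow_const G a * v + v')) ->
  (forall s, chainset s -> #|s| = d -> K (\prod_(S in s) xclass S)) -> K u.

Lemma chain_span0 d : chain_span d 0.
Proof. by []. Qed.

Lemma chain_span_comb d a u v : chain_span d u -> chain_span d v ->
  chain_span d (chow_const G a * u + v).
Proof. by move=> su sv K K0 KD Ks; exact: KD (su K K0 KD Ks) (sv K K0 KD Ks). Qed.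

Lemma chain_span_sum d (I : Type) (r : seq I) (B : pred I) (F : I -> chow G) :
  (forall i, B i -> chain_span d (F i)) -> chain_span d (\sum_(i <- r | B i) F i).
Proof.
move=> H; elim/big_rec: _ => // i u Bi IHu.
by rewrite -[F i]mul1r -chow_const1; apply: chain_span_comb => //; apply: H.
Qed.

Lemma chain_spanZ d a u : chain_span d u -> chain_span d (chow_const G a * u).
Proof. by move=> su; rewrite -[_ * u]addr0; apply: chain_span_comb. Qed.

Lemma chain_spanN d u : chain_span d u -> chain_span d (- u).
Proof.
have -> : - u = chow_const G (- 1) * u by rewrite chow_constN chow_const1 mulN1r.
exact: chain_spanZ.
Qed.

Lemma xclass_mul_chain S s : chainset s -> S \notin s ->
  xclass S * \prod_(T in s) xclass T =
    if chainset (S |: s) then \prod_(T in S |: s) xclass T else 0.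
Proof.
move=> chs Ss; case: ifPn => [_|nch]; first by rewrite big_setU1.
have [T Ts nST] : exists2 T, T \in s & ~~ cmp S T.
  apply/exists_inP; apply: contraNT nch; rewrite negb_exists_in => /forall_inP H.
  apply/chainsetP => T T'; rewrite !inE => /predU1P[->|Ts] /predU1P[->|T's].
  - exact: cmpxx.
  - by have := H _ T's; rewrite negbK.
  - by have := H _ Ts; rewrite negbK cmpC.
  - exact: (chainsetP _ chs).
by rewrite (bigD1 T) //= mulrA xclass_incomp // mul0r.
Qed.

(** If [S] already occurs in the chain, the linear relation with value 1 on [S] and 0 on the other
    members trades [x_S] for variables outside the chain. *)
Lemma chain_span_xclass d S u : chain_span d u -> chain_span d.+1 (xclass S * u).
Proof.
move=> su; apply: (su (fun v => chain_span d.+1 (xclass S * v)))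
  => [|a v v' sv sv'|s chs cs]; first by rewrite mulr0.
  by rewrite mulrDr mulrCA; apply: chain_span_comb.
have out T : T \notin s -> chain_span d.+1 (xclass T * \prod_(R in s) xclass R).
  move=> Ts; rewrite xclass_mul_chain //; case: ifP => ch; last exact: chain_span0.
  by move=> K _ _; apply=> //; rewrite cardsU1 Ts cs.
have [Ss|Ss] := boolP (S \in s); last exact: out.
have [c c0 cP] := chain_separate chs Ss.
have := congr1 (fun x => x * \prod_(R in s) xclass R) (xclass_lin c0).
rewrite mul0r mulr_suml (bigID (mem s)) /= (bigD1 S) //= cP // eqxx chow_const1 mul1r.
rewrite [X in _ + X + _]big1 ?addr0 => [|T /andP[Ts nTS]]; last first.
  by rewrite cP // (negbTE nTS) chow_const0 !mul0r.
move/eqP; rewrite addr_eq0 => /eqP->.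
apply: chain_spanN.
by apply: chain_span_sum => T Ts; rewrite -mulrA; exact: (chain_spanZ _ (out T Ts)).
Qed.

Lemma chain_span_homog d p : p \is d.-homog -> chain_span d (cls p).
Proof.
move=> /dhomogP hp; rewrite [p]mpolyE chow_class_sum big_seq_cond.
apply: chain_span_sum => m /andP[/hp dm _]; rewrite chow_classZ; apply: chain_spanZ.
have {dm} <- : mdeg m = d by [].
elim/mnm_addU_ind: m => [|i m IHm].
  rewrite mpolyX0 chow_class1 mdeg0 => K _ _ /(_ set0); rewrite big_set0; apply.
    by apply/chainsetP => ?; rewrite inE.
  by rewrite cards0.
rewrite mdegD mdeg1 add1n mpolyXD chow_classM -(enum_valK i).
exact: (@chain_span_xclass _ (enum_val i)).
Qed.

(** * Chains as increasing lists and as sets *)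

Lemma chain_seq_set k (l : seq V) : is_chain k l ->
  [/\ uniq l, chainset [set S in l] & #|[set S in l]| = k].
Proof.
case/andP => /eqP <- sl.
have tr : transitive (fun S T : V => val S \proper val T).
  by move=> ? ? ?; apply: proper_trans.
have ul : uniq l by apply: sorted_uniq sl => // S; rewrite properxx.
split=> //; last by rewrite cardsE; apply/card_uniqP.
move: sl; rewrite (sorted_pairwise tr) => pl; apply/chainsetP => S T; rewrite !inE.
elim: l pl {ul} => //= R l IHl /andP[/allP aR pl].
rewrite !inE => /predU1P[->|Sl] /predU1P[->|Tl].
- exact: cmpxx.
- by rewrite /cmp proper_sub ?aR.
- by rewrite /cmp orbC proper_sub ?aR.
- exact: IHl.
Qed.

Lemma chain_set_seq s : chainset s -> exists2 l, is_chain #|s| l & perm_eq l (enum s).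
Proof.
move=> chs; pose l := sort (fun S T : V => val S \subset val T) (enum s).
have pl : perm_eq l (enum s) by apply/permPl/perm_sort.
exists l => //; rewrite /is_chain size_sort -cardE eqxx /=.
have sl : sorted (fun S T : V => val S \subset val T) l.
  apply: (sort_sorted_in (P := mem s)) => [S T Ss Ts|].
    exact: (chainsetP _ chs).
  by apply/allP => S; rewrite mem_enum.
have tr : transitive (fun S T : V => val S \subset val T).
  by move=> ? ? ?; apply: subset_trans.
have ul : uniq l by rewrite (perm_uniq pl) enum_uniq.
have : sorted (fun S T : V => (val S \subset val T) && (S != T)) l.
  move: sl ul; rewrite (sorted_pairwise tr) uniq_pairwise => sl ul.
  have := conj sl ul => /andP; rewrite -pairwise_relI; exact: pairwise_sorted.
apply: sub_sorted => S T /andP[ST nST]; rewrite properEneq ST andbT.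
by apply: contra nST => /eqP/val_inj->.
Qed.

Lemma perm_prod_chain (l : seq V) s (F : V -> chow G) : perm_eq l (enum s) ->
  \prod_(S <- l) F S = \prod_(S in s) F S.
Proof. by move=> pl; rewrite (perm_big _ pl) big_enum. Qed.

Lemma chain_class_set k (l : seq V) : is_chain k l ->
  chain_class l = \prod_(S in [set S in l]) xclass S.
Proof.
case/chain_seq_set => ul _ _; rewrite /chain_class.
by apply: perm_prod_chain; apply: uniq_perm; rewrite ?enum_uniq // => S; rewrite mem_enum inE.
Qed.

(** This is the class [L_m]: its coefficient is [min(1,|S|)] minus the indicator of the base point
    in [S]. *)
Definition beta (h : G) : chow G := \sum_(S : V | h \notin val S) xclass S.

Lemma beta_indep g h : beta g = beta h.
Proof.
have H e : \sum_S xclass S = (\sum_(S : V | e \in val S) xclass S) + beta e.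
  exact: (bigID (fun S : V => e \in val S)).
by apply: (addrI (\sum_(S : V | g \in val S) xclass S)); rewrite -H (xclass_point g h) -H.
Qed.

(** Move one base point to some [h] in [S]: the terms of [beta h] comparable with [S] are proper
    subsets of [S], and the remaining power of [beta] kills them by induction. *)
Lemma beta_xclass g S : beta g ^+ #|val S| * xclass S = 0.
Proof.
have [k] := ubnP #|val S|; elim: k S => // k IHk S leSk.
have [h hS] := psubset_neq0 S.
have := leSk; have -> : #|val S| = #|val S|.-1.+1 by rewrite prednK // (cardD1 h) hS.
rewrite ltnS => Sk.
rewrite exprSr -mulrA {2}(beta_indep g h) /beta mulr_suml mulr_sumr big1 // => T hT.
have [|nc] := boolP (cmp T S); last by rewrite xclass_incomp // mulr0.
rewrite /cmp => /orP[TS|ST]; last by case/negP: hT; apply: (subsetP ST).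
have lTS : (#|val T| < #|val S|)%N.
  by apply: proper_card; apply/properP; split=> //; exists h.
rewrite mulrA -(subnK (_ : #|val T| <= #|val S|.-1)%N); last first.
  by rewrite -ltnS prednK // (leq_ltn_trans _ lTS).
by rewrite exprD -[X in X * _]mulrA IHk ?mulr0 ?mul0r // (leq_trans lTS).
Qed.

(* The members of a complete chain can be traded for [beta] one at a time from below: if [h] is the
   element added by the step following [F], then the only term of [beta h] that survives after
   multiplication by [beta ^+ i] and the sets above [F] is [F] itself. *)
Lemma complete_chain_beta g (l : seq V) : is_chain (pdim G) l ->
  chain_class l = beta g ^+ pdim G.
Proof.
move=> chl; have /andP[/eqP szl sl] := chl.
have tr : transitive (fun S T : V => val S \proper val T).
  by move=> ? ? ?; apply: proper_trans.
have ltc (S0 : V) i j : (i < j < pdim G)%N -> val (nth S0 l i) \proper val (nth S0 l j).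
  case/andP=> ij jm; apply: (sorted_ltn_nth tr) => //; rewrite inE szl //.
  exact: ltn_trans jm.
have card_ge (S0 : V) i : (i < pdim G)%N -> (i < #|val (nth S0 l i)|)%N.
  elim: i => [|i IHi] im.
    by have [e eS] := psubset_neq0 (nth S0 l 0); rewrite (cardD1 e) eS.
  apply: leq_trans (proper_card (ltc S0 i i.+1 _)); last by rewrite ltnSn.
  by rewrite ltnS IHi // ltnW.
have card_le (S0 : V) k i : (i + k.+1 = pdim G)%N -> (#|val (nth S0 l i)| + k < #|G|)%N.
  elim: k i => [|k IHk] i ik.
    have [e eS] := psubset_neqT (nth S0 l i); rewrite addn0 -cardsT.
    by apply/proper_card/properP; split; [apply: subsetT | exists e].
  have {}IHk := IHk i.+1; rewrite addSnnS in IHk.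
  apply: leq_ltn_trans (IHk ik); rewrite addnS -addSn leq_add2r.
  by apply/proper_card/ltc; rewrite ltnSn -ik /= !addnS !ltnS leq_addr.
have cardF (S0 : V) i : (i < pdim G)%N -> #|val (nth S0 l i)| = i.+1.
  move=> im; apply/eqP; rewrite eqn_leq card_ge // andbT.
  have := card_le S0 (pdim G - i.+1)%N i; move: im; rewrite /pdim; lia.
have step i : (i <= pdim G)%N ->
    chain_class l = beta g ^+ i * \prod_(S <- drop i l) xclass S.
  elim: i => [|i IHi] im; first by rewrite mul1r drop0.
  have il : (i < size l)%N by rewrite szl.
  have [S0 _] : exists S0 : V, S0 \in l by case: (l) il => // S0 ? _; exists S0; rewrite mem_head.
  rewrite IHi ?(ltnW im) // (drop_nth S0) // big_cons.
  set F := nth S0 l i; set D := \prod_(S <- _) _.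
  have cF : #|val F| = i.+1 by apply: cardF.
  suff [h hF hD] : exists2 h, h \notin val F & forall S, h \notin val S ->
      xclass S * D != 0 -> val S \subset val F.
    rewrite exprSr -mulrA (beta_indep g h) {2}/beta mulr_suml mulr_sumr (bigD1 F) //=.
    rewrite [X in _ + X]big1 ?addr0 // => S /andP[hS nSF].
    have [->|/(hD S hS) SF] := eqVneq (xclass S * D) 0; first by rewrite mulr0.
    have lt : (#|val S| <= i)%N.
      rewrite -ltnS -cF; apply: proper_card; rewrite properEneq SF andbT.
      by apply: contra nSF => /eqP/val_inj->.
    by rewrite mulrA -(subnK lt) exprD -[X in X * D]mulrA beta_xclass mulr0 mul0r.
  (* [B] is what follows [F] in the chain, the ground set when [F] is last. The sizes leave a single
     element [h] of [B] outside [F], so a subset of [B] that misses [h] is contained in [F]. *)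
  have [B [FB cB hB]] : exists B : {set G}, [/\ val F \proper B, #|B| = i.+2 &
      forall S h, h \in B -> h \notin val S -> xclass S * D != 0 -> val S \subset B].
    move: im; rewrite leq_eqVlt => /predU1P[im|im].
      exists setT; split; last by move=> *; apply: subsetT.
        have [h hF] := psubset_neqT F.
        by apply/properP; split; [apply: subsetT | exists h].
      have := card_le S0 0 i; rewrite cardsT addn1 => /(_ im); rewrite -/F cF.
      by move: im; rewrite /pdim; lia.
    exists (val (nth S0 l i.+1)); split; rewrite ?cardF ?ltc ?ltnSn //.
    move=> S h hn hS; rewrite /D (drop_nth S0) ?szl // big_cons mulrA.
    have [/orP[//|nS]|nc] := boolP (cmp S (nth S0 l i.+1)).
      by case/negP: hS; apply: (subsetP nS).
    by rewrite xclass_incomp // mul0r eqxx.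
  have /properP[sFB [h hin hF]] := FB; exists h => // S hS /(hB _ _ hin hS) SB.
  have -> : val F = B :\ h.
    apply/eqP; rewrite eqEcard subsetD1 sFB hF /=.
    by have := cardsD1 h B; rewrite hin cB cF; clear; lia.
  by rewrite subsetD1 SB hS.
by rewrite (step (pdim G)) // -szl drop_size big_nil mulr1.
Qed.

End ChowTheory.

(** * The weight of a matroid *)

Section MatroidWeight.
Variable G : finType.
Local Notation V := (psubset G).
Implicit Types (S T R Q : V) (s : {set V}) (w : {set V} -> rat) (M N : matroid G).
Implicit Types (A B F : {set G}) (c : G -> rat).

Definition cl M A := [set x | rk M (x |: A) == rk M A].

Lemma rk_set0 M : rk M set0 = 0%N.
Proof. by apply/eqP; rewrite -leqn0 -(cards0 G) rk_card. Qed.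

Lemma rk_le_mrank M A : (rk M A <= mrank M)%N.
Proof. exact/rk_mono/subsetT. Qed.

Lemma sub_cl M A : A \subset cl M A.
Proof. by apply/subsetP => x xA; rewrite inE (setUidPr _) // sub1set. Qed.

Lemma rk_setU1_le M A x : (rk M (x |: A) <= (rk M A).+1)%N.
Proof.
have := rk_submod M [set x] A; have := rk_card M [set x]; rewrite cards1; lia.
Qed.

Lemma rk_cl_sub M A B : B \subset cl M A -> rk M (B :|: A) = rk M A.
Proof.
have [k] := ubnP #|B|; elim: k B => // k IHk B leB BA.
have [->|[x xB]] := set_0Vmem B; first by rewrite set0U.
have cB := cardsD1 x B; rewrite xB in cB.
have IH : rk M ((B :\ x) :|: A) = rk M A.
  by apply: IHk; [lia | rewrite (subset_trans _ BA) // subD1set].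
have xA : rk M (x |: A) = rk M A by have := subsetP BA _ xB; rewrite inE => /eqP.
apply/eqP; rewrite eqn_leq [X in _ && X]rk_mono ?subsetUr // andbT.
have := rk_submod M (x |: A) ((B :\ x) :|: A).
rewrite setUACA setUid setD1K // xA IH.
have : (rk M A <= rk M ((x |: A) :&: (B :\ x :|: A)))%N.
  by rewrite rk_mono // subsetI !subsetUr.
lia.
Qed.

Lemma rk_cl M A : rk M (cl M A) = rk M A.
Proof. by rewrite -(@rk_cl_sub M A (cl M A)) // (setUidPl (sub_cl M A)). Qed.

Lemma flat_cl M A : flat M (cl M A).
Proof.
apply/forallP => x; apply/implyP; rewrite inE rk_cl => nx.
have : (rk M A <= rk M (x |: A))%N by rewrite rk_mono ?subsetUr.
have : (rk M (x |: A) <= rk M (x |: cl M A))%N by rewrite rk_mono // setUS // sub_cl.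
lia.
Qed.

Lemma flatP M F : reflect (forall x, x \notin F -> (rk M F < rk M (x |: F))%N) (flat M F).
Proof. by apply: (iffP forallP) => H x; apply/implyP/H. Qed.

Lemma flat_rk_lt M F A : flat M F -> F \proper A -> (rk M F < rk M A)%N.
Proof.
move=> /flatP fF /properP[FA [x xA xF]]; apply: leq_trans (fF _ xF) _.
by rewrite rk_mono // subUset sub1set xA.
Qed.

Lemma flat_setT M : flat M [set: G].
Proof. by apply/flatP => x; rewrite inE. Qed.

Lemma cl_sub_flat M F A : flat M F -> A \subset F -> cl M A \subset F.
Proof.
move=> /flatP fF AF; apply/subsetP => x; rewrite inE => /eqP xA.
apply/negPn/negP => /fF.
have := rk_submod M (x |: A) F.
rewrite -setUA (setUidPr AF) xA.
have : (rk M A <= rk M ((x |: A) :&: F))%N by rewrite rk_mono // subsetI subsetUr.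
lia.
Qed.

Lemma loopless_rk1 M x : loopless M -> rk M [set x] = 1%N.
Proof. by move/forallP/(_ x)/eqP. Qed.

Lemma flat_set0 M : loopless M -> flat M set0.
Proof. by move=> lM; apply/flatP => x _; rewrite setU0 rk_set0 loopless_rk1. Qed.

Lemma rk_gt0 M A x : loopless M -> x \in A -> (0 < rk M A)%N.
Proof. by move=> lM xA; rewrite -(loopless_rk1 x lM) rk_mono // sub1set. Qed.

Definition wt M s : rat :=
  [&& chainset s, #|s|.+1 == mrank M & [forall S in s, flat M (val S)]]%:R.

Lemma wt_supp M s : wt M s != 0 -> #|s| = (mrank M).-1.
Proof. by rewrite /wt; case: and3P => [[_ /eqP<-]|]; rewrite ?eqxx. Qed.

(** The chain together with the empty set and the ground set, which are not of type [psubset]. *)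
Definition ext s A := [\/ A = set0, A = setT | exists2 T, T \in s & A = val T].

Lemma ext_comp s A B : chainset s -> ext s A -> ext s B -> A \subset B \/ B \subset A.
Proof.
move=> /chainsetP chs [->|->|[T Ts ->]]; first by left; apply: sub0set.
  by right; apply: subsetT.
move=> [->|->|[T' T's ->]]; [by right; apply: sub0set | by left; apply: subsetT |].
by have /orP := chs _ _ Ts T's.
Qed.

Lemma ext_flat M s A : loopless M -> {in s, forall S, flat M (val S)} -> ext s A -> flat M A.
Proof. by move=> lM fs [->|->|[T /fs ? ->]] //; [apply: flat_set0 | apply: flat_setT]. Qed.

Lemma flat_chain_inj M s : chainset s -> {in s, forall S, flat M (val S)} ->
  {in s &, injective (fun S : V => rk M (val S))}.
Proof.
move=> /chainsetP chs fs S T Ss Ts e; apply/val_inj/eqP.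
have := chs _ _ Ss Ts; rewrite /cmp !subEproper => /orP[] /orP[/eqP->|] //.
  by move/(flat_rk_lt (fs _ Ss)); rewrite e ltnn.
by move/(flat_rk_lt (fs _ Ts)); rewrite e ltnn.
Qed.

Lemma flat_rk_bounds M S : loopless M -> flat M (val S) ->
  (0 < rk M (val S) < mrank M)%N.
Proof.
move=> lM fS; have [e eS] := psubset_neq0 S; rewrite (rk_gt0 lM eS) /=.
apply: flat_rk_lt => //; have [h hS] := psubset_neqT S.
by apply/properP; split; [apply: subsetT | exists h].
Qed.

(** Rank is injective on a chain of flats, with values strictly between 0 and [mrank M]. There are
    [mrank M - 1] such values, so exactly one is missed, namely [k.+1]. *)
Lemma flag_gap M s : loopless M -> chainset s -> {in s, forall S, flat M (val S)} ->
  #|s|.+2 = mrank M ->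
  exists k, [/\ (k.+2 <= mrank M)%N, {in s, forall S, rk M (val S) != k.+1} &
    forall i, (i <= mrank M)%N -> i != k.+1 -> exists2 A, ext s A & rk M A = i].
Proof.
move=> lM chs fs cs.
pose r S : 'I_(mrank M).+1 := inord (rk M (val S)).
have rE S : r S = rk M (val S) :> nat by rewrite inordK // ltnS rk_le_mrank.
pose I := [set i : 'I_(mrank M).+1 | 0 < i < mrank M]%N.
have cI : #|I| = (mrank M).-1.
  have -> : I = ~: [set ord0; ord_max].
    apply/setP => i; rewrite !inE negb_or -!val_eqE /= lt0n.
    by have := ltn_ord i; case: (i == 0 :> nat); lia.
  by rewrite cardsCs setCK cards2 card_ord -val_eqE /=; case: eqP; lia.
have ri : {in s &, injective r}.
  by move=> S T Ss Ts /(congr1 val) /=; rewrite -!/(nat_of_ord _) !rE; apply: (flat_chain_inj chs fs).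
have crs : #|r @: s| = #|s| by apply: card_in_imset.
have sub : r @: s \subset I.
  by apply/subsetP => i /imsetP[S Ss ->]; rewrite inE rE flat_rk_bounds ?fs.
have : #|I :\: r @: s| == 1%N by rewrite cardsD (setIidPr sub) cI crs; lia.
case/cards1P => k kP; have : k \in I :\: r @: s by rewrite kP set11.
rewrite !inE => /and3P[ks k0 km]; exists k.-1; split.
- by lia.
- move=> S Ss; rewrite prednK // -rE; apply: contra ks => /eqP e.
  by apply/imsetP; exists S => //; apply: ord_inj.
move=> i im; rewrite prednK // => ik.
have [->|i0] := posnP i; first by exists set0; [apply: Or31 | rewrite rk_set0].
move: im; rewrite leq_eqVlt => /predU1P[->|im]; first by exists setT; [apply: Or32|].
pose j : 'I_(mrank M).+1 := inord i.
have jE : j = i :> nat by rewrite inordK // ltnW.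
have : j \in r @: s.
  have : j \notin I :\: r @: s by rewrite kP inE -val_eqE /= -/(nat_of_ord _) jE.
  by rewrite !inE jE i0 im /= andbT negbK.
by case/imsetP => S Ss e; exists (val S); [apply: Or33; exists S | rewrite -rE -e jE].
Qed.


(** A cone of codimension one in the Bergman fan: [F] and [F'] are the neighbours of the missing
    rank [k.+1], and the flats strictly between them are what completes the flag. *)
Record gap M s (k : nat) F F' : Prop := Gap {
  gap_flat : flat M F; gap_flat' : flat M F';
  gap_rk : rk M F = k; gap_rk' : rk M F' = k.+2;
  gap_sub : F \subset F';
  gap_ext : ext s F; gap_ext' : ext s F';
  gap_le : {in s, forall S, (rk M (val S) <= k)%N -> val S \subset F};
  gap_ge : {in s, forall S, (k < rk M (val S))%N -> F' \subset val S};
  gap_wt : forall R, R \notin s -> wt M (R |: s) =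
     [&& flat M (val R), F \proper val R & val R \proper F']%:R
}.

Lemma ext_rk_sub M s A B : loopless M -> chainset s -> {in s, forall S, flat M (val S)} ->
  ext s A -> ext s B -> (rk M A <= rk M B)%N -> A \subset B.
Proof.
move=> lM chs fs eA eB le; have [//|BA] := ext_comp chs eA eB.
have [-> //|nAB] := eqVneq A B.
have : B \proper A by rewrite properEneq eq_sym nAB.
by move/(flat_rk_lt (ext_flat lM fs eB)); rewrite ltnNge le.
Qed.

Lemma between_rk M F F' A k : flat M F -> rk M F = k -> rk M F' = k.+2 ->
  flat M A -> F \proper A -> A \proper F' -> rk M A = k.+1.
Proof.
by move=> fF rF rF' fA /(flat_rk_lt fF) + /(flat_rk_lt fA); rewrite rF rF'; lia.
Qed.

(** A completing flat must have the missing rank: at any other rank the extended flag already has a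
    member, and flats of equal rank in a flag coincide. *)
Lemma flag_gapP M s : loopless M -> chainset s -> {in s, forall S, flat M (val S)} ->
  #|s|.+2 = mrank M -> exists k F F', gap M s k F F'.
Proof.
move=> lM chs fs cs; have [k [km ks kP]] := flag_gap lM chs fs cs.
have [F eF rF] : exists2 A, ext s A & rk M A = k by apply: kP; lia.
have [F' eF' rF'] : exists2 A, ext s A & rk M A = k.+2 by apply: kP; lia.
have fF := ext_flat lM fs eF; have fF' := ext_flat lM fs eF'.
have eS S : S \in s -> ext s (val S) by move=> Ss; apply: Or33; exists S.
have le S : S \in s -> (rk M (val S) <= k)%N -> val S \subset F.
  by move=> Ss rS; apply: (ext_rk_sub lM chs fs (eS _ Ss) eF); rewrite rF.
have ge S : S \in s -> (k < rk M (val S))%N -> F' \subset val S.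
  move=> Ss rS; apply: (ext_rk_sub lM chs fs eF' (eS _ Ss)); rewrite rF'.
  by have := ks _ Ss; lia.
exists k, F, F'; split => //; first by apply: (ext_rk_sub lM chs fs eF eF'); lia.
move=> R Rs; rewrite /wt; congr (nat_of_bool _)%:R.
rewrite cardsU1 Rs add1n cs eqxx /=; apply/andP/and3P.
  move=> [chR /forall_inP fR]; have {}fR S : S \in R |: s -> flat M (val S) by apply: fR.
  have fRR : flat M (val R) by rewrite fR ?setU11.
  have rR : rk M (val R) = k.+1.
    apply/eqP; apply: contraT => /(kP _ (rk_le_mrank _ _)) [A eA rA].
    have := flat_rk_bounds lM fRR; rewrite -rA.
    case: eA => [->|->|[T Ts AT]]; [by rewrite rk_set0|by rewrite ltnn andbF|].
    rewrite AT in rA; case/negP: Rs.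
    by have <- // : T = R; apply: (flat_chain_inj chR fR); rewrite ?setU11 // inE Ts orbT.
  have eR : ext (R |: s) (val R) by apply: Or33; exists R; rewrite ?setU11.
  have extS A : ext s A -> ext (R |: s) A.
    case=> [->|->|[T Ts ->]]; [exact: Or31|exact: Or32|].
    by apply: Or33; exists T; rewrite // inE Ts orbT.
  split=> //; rewrite properEneq.
    apply/andP; split; first by apply/eqP => e; move: rF; rewrite e rR => /esym/n_Sn.
    by apply: (ext_rk_sub lM chR fR (extS _ eF) eR); rewrite rF rR.
  apply/andP; split; first by apply/eqP => e; move: rF'; rewrite -e rR => /n_Sn.
  by apply: (ext_rk_sub lM chR fR eR (extS _ eF')); rewrite rF' rR.
move=> [fR FR RF']; have [sFR sRF] := (proper_sub FR, proper_sub RF'); split.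
  apply/chainsetP => S T; rewrite !inE => /predU1P[->|Ss] /predU1P[->|Ts].
  - exact: cmpxx.
  - have [/(le _ Ts) TF|/(ge _ Ts) FT] := leqP (rk M (val T)) k.
      by rewrite cmpC /cmp (subset_trans TF sFR).
    by rewrite /cmp (subset_trans sRF FT).
  - have [/(le _ Ss) SF|/(ge _ Ss) FS] := leqP (rk M (val S)) k.
      by rewrite /cmp (subset_trans SF sFR).
    by rewrite cmpC /cmp (subset_trans sRF FS).
  - exact: (chainsetP _ chs).
by apply/forall_inP => S; rewrite !inE => /predU1P[->|/fs].
Qed.

Lemma gap_between_notin M s k F F' R : gap M s k F F' ->
  [&& flat M (val R), F \proper val R & val R \proper F'] -> R \notin s.
Proof.
move=> g /and3P[fR FR RF']; apply/negP => Rs.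
have rR := between_rk (gap_flat g) (gap_rk g) (gap_rk' g) fR FR RF'.
by have := gap_ge g Rs; rewrite rR ltnSn => /(_ isT) /(proper_sub_trans RF'); rewrite properxx.
Qed.

Lemma gap_sum M s k F F' (f : V -> rat) : gap M s k F F' -> {in s, forall S, f S = 0} ->
  \sum_R f R * wt M (R |: s) =
  \sum_(R : V | [&& flat M (val R), F \proper val R & val R \proper F']) f R.
Proof.
move=> g fs; rewrite [RHS]big_mkcond; apply: eq_bigr => R _.
have [Rs|Rs] := boolP (R \in s).
  by rewrite fs // mul0r; case: ifP => // /(gap_between_notin g); rewrite Rs.
by rewrite (gap_wt g) //; case: ifP; rewrite ?mulr1 ?mulr0.
Qed.

Lemma psubset_ex F A F' : F \proper A -> A \proper F' -> exists R : V, val R = A.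
Proof.
move=> FA AF'; have pA : (A != set0) && (A \proper [set: G]).
  rewrite -card_gt0 (leq_ltn_trans _ (proper_card FA)) //=.
  exact: proper_sub_trans AF' (subsetT _).
by exists (Sub A pA); rewrite SubK.
Qed.

(* The flats between [F] and [F'] partition [F' :\: F]; this is the balancing condition. *)
Lemma between_sum M F F' c : flat M F -> flat M F' -> rk M F' = (rk M F).+2 -> F \subset F' ->
  \sum_(R : V | [&& flat M (val R), F \proper val R & val R \proper F'])
     (linf c (val R) - linf c F) = linf c F' - linf c F.
Proof.
move=> fF fF' rF' FF'.
rewrite (linf_sum c FF') addrAC subrr add0r.
transitivity (\sum_(R : V | [&& flat M (val R), F \proper val R & val R \proper F'])
   \sum_(e in F' :\: F | e \in val R) c e).
  apply: eq_bigr => R /and3P[_ FR RF'].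
  rewrite (linf_sum c (proper_sub FR)) addrAC subrr add0r; apply: eq_bigl => e.
  rewrite !inE -andbA; congr (_ && _); case: (boolP (e \in val R)); rewrite ?andbF // => eR.
  by rewrite (subsetP (proper_sub RF')).
rewrite (exchange_big_dep (fun e => e \in F' :\: F)) /=; last by move=> ? ? _ /andP[].
rewrite [RHS]/linf; apply: eq_bigr => e eF.
have eFF := eF; rewrite inE in eFF; case/andP: eFF => enF eF'.
(* The only flat strictly between [F] and [F'] that contains [e] is the closure of [e |: F], since
   its rank is already one above that of [F]. *)
have rU : rk M (e |: F) = (rk M F).+1.
  by apply/eqP; rewrite eqn_leq rk_setU1_le; move/flatP: fF; apply.
have FA : F \proper cl M (e |: F).
  apply: proper_sub_trans (sub_cl _ _); apply/properP; split; first exact: subsetUr.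
  by exists e; rewrite ?setU11.
have AF' : cl M (e |: F) \proper F'.
  rewrite properEneq cl_sub_flat ?andbT //; last by rewrite subUset sub1set eF'.
  by apply/eqP => E; move: rF'; rewrite -E rk_cl rU; lia.
have [R0 R0E] := psubset_ex FA AF'.
rewrite (big_pred1 R0) // => R; apply/andP/eqP => [[/and3P[fR FR RF'] /andP[_ eR]]|->].
  apply/val_inj/eqP; rewrite R0E eq_sym; apply/eqP/eqP.
  have sub : cl M (e |: F) \subset val R.
    by apply: cl_sub_flat; rewrite // subUset sub1set eR (proper_sub FR).
  rewrite eq_sym; apply: contraT => ne.
  have : cl M (e |: F) \proper val R by rewrite properEneq eq_sym ne.
  move/(flat_rk_lt (flat_cl _ _)); rewrite rk_cl rU.
  by rewrite (between_rk fF erefl rF' fR FR RF') ltnn.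
rewrite R0E flat_cl FA AF' eF; split=> //.
by rewrite (subsetP (sub_cl _ _)) // setU11.
Qed.

Lemma ext_linf s A c phi : \sum_e c e = 0 -> {in s, forall S, linf c (val S) = phi (val S)} ->
  phi set0 = 0 -> phi [set: G] = 0 -> ext s A -> linf c A = phi A.
Proof. by move=> c0 cP p0 pT [->|->|[T Ts ->]]; rewrite ?linf0 ?linfT ?cP ?p0 ?pT. Qed.

(** Only a chain of flats that lacks one member needs an argument: there [c] vanishes at both ends
    of the gap, and [between_sum] applies. *)
Lemma wt_balanced M : loopless M -> balanced (wt M).
Proof.
move=> lM; split=> [s|s c c0 cP].
  by apply: contraNT => nch; rewrite /wt (negbTE nch).
have [Hch|nch] := boolP (chainset s); last first.
  rewrite big1 // => R _; rewrite /wt (_ : chainset _ = false) ?mulr0 //.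
  by apply/negbTE; apply: contra nch; apply/chainsetS/subsetUr.
have [/forall_inP fs|nf] := boolP [forall S in s, flat M (val S)]; last first.
  rewrite big1 // => R _; rewrite /wt [X in _ && (_ && X)](_ : _ = false) ?andbF ?mulr0 //.
  apply/negbTE; apply: contra nf => /forall_inP H; apply/forall_inP => S Ss.
  by apply: H; rewrite inE Ss orbT.
have [cs|ncs] := eqVneq #|s|.+2 (mrank M); last first.
  rewrite big1 // => R _; have [Rs|Rs] := boolP (R \in s); first by rewrite cP ?mul0r.
  by rewrite /wt cardsU1 Rs add1n (negbTE ncs) andbF mulr0.
have [k [F [F' g]]] := flag_gapP lM Hch fs cs.
rewrite (gap_sum g) //.
have z A : ext s A -> linf c A = 0 by apply: (ext_linf (phi := fun=> 0)).
have := between_sum c (gap_flat g) (gap_flat' g) _ (gap_sub g).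
rewrite (gap_rk g) (gap_rk' g) (z F) ?(z F') ?subr0; try exact: (gap_ext g); try exact: (gap_ext' g).
by move=> /(_ erefl) e; rewrite -[RHS]e; apply: eq_bigr => R _; rewrite subr0.
Qed.

End MatroidWeight.

(** * Elementary quotients and the Higgs lift *)

Section Quotient.
Variable G : finType.
Local Notation V := (psubset G).
Implicit Types (S T R Q : V) (s : {set V}) (A B F : {set G}) (c : G -> rat).
(** The setting of an elementary quotient [M] of [N]: [phi] is the drop of the rank, and the flats
    of [N] satisfying it form the modular cut of the quotient. *)
Variables (N M : matroid G) (phi : {set G} -> bool).
Hypotheses (lN : loopless N) (lM : loopless M).
Hypothesis rkN : forall A, rk N A = (rk M A + phi A)%N.
Hypothesis phiS : forall A B, A \subset B -> phi A -> phi B.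
Hypothesis phiT : phi [set: G].

Lemma quotient_phi0 : phi set0 = false.
Proof. by have := rkN set0; rewrite !rk_set0; case: (phi set0). Qed.

Lemma quotient_mrank : mrank N = (mrank M).+1.
Proof. by rewrite /mrank rkN phiT addn1. Qed.

Lemma quotient_flat F : flat M F -> flat N F.
Proof.
move=> /flatP fF; apply/flatP => x xF; rewrite !rkN.
have := fF x xF; have := @phiS F (x |: F) (subsetUr _ _).
by case: (phi F) => [/(_ isT)->|_]; lia.
Qed.

(** The indicator of [g] minus [c] is a linear function that agrees with [phi] on the whole extended
    flag. The partition of [F' :\: F] by the flats in between then eliminates [g] and [c]. *)
Lemma quotient_sum s k F F' g c : chainset s -> gap N s k F F' ->
  \sum_e c e = 0 ->
  {in s, forall S, linf c (val S) = (g \in val S)%:R - (phi (val S))%:R} ->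
  \sum_(R : V) ((g \in val R)%:R - (phi (val R))%:R - linf c (val R)) * wt N (R |: s)
  = (phi F')%:R - (phi F)%:R
    - \sum_(R : V | [&& flat N (val R), F \proper val R & val R \proper F'])
        ((phi (val R))%:R - (phi F)%:R).
Proof.
move=> chs gp c0 cP; rewrite (gap_sum gp); last by move=> S Ss; rewrite cP ?subrr.
pose d e := (e == g)%:R - c e.
have dE A : linf d A = (g \in A)%:R - linf c A by rewrite linfB linf1.
have cE A : ext s A -> linf c A = (g \in A)%:R - (phi A)%:R.
  apply: (ext_linf (phi := fun A => (g \in A)%:R - (phi A)%:R)) => //.
    by rewrite quotient_phi0 inE subrr.
  by rewrite phiT inE subrr.
have dF A : ext s A -> linf d A = (phi A)%:R.
  by move=> eA; rewrite dE cE // opprB addrC subrK.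
have := between_sum d (gap_flat gp) (gap_flat' gp) _ (gap_sub gp).
rewrite (gap_rk gp) (gap_rk' gp) => /(_ erefl).
rewrite (dF _ (gap_ext gp)) (dF _ (gap_ext' gp)).
move=> <-; rewrite -sumrB; apply: eq_bigr => R _.
by rewrite dE opprB addrA subrK addrAC.
Qed.

(** The rank in [M] strictly increases along the flag. Counting from the bottom gives [rk M >= rk N]
    up to [F]; counting from the top, where [M] has rank one less, gives [rk M < rk N] down to [F'].
    So [phi] jumps exactly across the gap. *)
Lemma quotient_chain_rk s k F F' : chainset s -> {in s, forall S, flat M (val S)} ->
  gap N s k F F' -> #|s|.+1 = mrank M -> ~~ phi F && phi F'.
Proof.
move=> chs fMs gp cs; have fNs S : S \in s -> flat N (val S) by move/fMs/quotient_flat.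
have [k' [km ks kP]] : exists k, [/\ (k.+2 <= mrank N)%N, {in s, forall S, rk N (val S) != k.+1} &
    forall i, (i <= mrank N)%N -> i != k.+1 -> exists2 A, ext s A & rk N A = i].
  by apply: flag_gap => //; rewrite quotient_mrank cs.
have lt A B : ext s A -> ext s B -> (rk N A < rk N B)%N -> (rk M A < rk M B)%N.
  move=> eA eB lt; apply: flat_rk_lt; first exact: ext_flat eA.
  rewrite properE (ext_rk_sub lN chs fNs eA eB (ltnW lt)) /=.
  by apply: contraTN lt => /(rk_mono N); rewrite -leqNgt.
have eF := gap_ext gp; have eF' := gap_ext' gp.
(* The extended flag has no member of rank [k.+1], so [k.+1] is the rank missed. *)
have kk : k' = k.
  apply/eqP; apply: contraT => ne.
  have [||A eA rA] := kP k.+1; rewrite ?eqSS 1?eq_sym //.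
    by have := rk_le_mrank N F'; rewrite (gap_rk' gp); lia.
  case: eA rA => [->|->|[T Ts ->] rT]; first by rewrite rk_set0.
    by move=> e; have := rk_le_mrank N F'; rewrite (gap_rk' gp) /mrank e ltnn.
  have := gap_ge gp Ts; rewrite rT ltnSn => /(_ isT)/(rk_mono N).
  by rewrite rT (gap_rk' gp) ltnn.
subst k'.
have lo i : (i <= k)%N -> exists A, [/\ ext s A, rk N A = i & (i <= rk M A)%N].
  elim: i => [|i IHi] ik; first by exists set0; split=> //; [exact: Or31 | exact: rk_set0].
  have [A [eA rA le]] := IHi (ltnW ik).
  have [||B eB rB] := kP i.+1; [lia|lia|exists B; split=> //].
  by apply: leq_ltn_trans le (lt _ _ eA eB _); rewrite rA rB.
have hi i : (i <= mrank N - k.+2)%N ->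
    exists A, [/\ ext s A, rk N A = (mrank N - i)%N & (rk M A < mrank N - i)%N].
  elim: i => [|i IHi] ik.
    exists setT; rewrite subn0; split=> //; [exact: Or32 | rewrite quotient_mrank; exact: ltnSn].
  have [A [eA rA le]] := IHi (ltnW ik).
  have [||B eB rB] := kP (mrank N - i.+1)%N; [lia|lia|exists B; split=> //].
  by have := lt _ _ eB eA; rewrite rA rB; lia.
have ext_eq A B : ext s A -> ext s B -> rk N A = rk N B -> A = B.
  move=> eA eB e; apply/eqP; rewrite eqEsubset.
  by rewrite !(ext_rk_sub lN chs fNs) // e.
have [A [eA rA leA]] := lo k (leqnn k).
have AF : A = F by apply: ext_eq; rewrite // rA (gap_rk gp).
have [B [eB rB leB]] := hi (mrank N - k.+2)%N (leqnn _).
rewrite subKn // in rB leB.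
have BF : B = F' by apply: ext_eq; rewrite // rB (gap_rk' gp).
subst A B; move: rA rB leA leB; rewrite !rkN.
by case: (phi F) (phi F') => [] []; lia.
Qed.

(** Only flags where [phi] fails at [F] and holds at [F'] can carry weight; there the divisor is 1
    minus the number of flats in between that satisfy [phi]. At most one does, and none does exactly
    when all members of the flag remain flats of [M]. The indicator of [g] makes the function vanish
    on the ground set. *)
Lemma quotient_wt g :
  act (fun S : V => (g \in val S)%:R - (phi (val S))%:R) (wt N) = wt M.
Proof.
apply: funext => s; have bN := wt_balanced lN.
have [chs|nch] := boolP (chainset s); last first.
  by rewrite act_chain // /wt (negbTE nch).
have [cs|ncs] := eqVneq #|s|.+1 (mrank M); last first.
  rewrite [wt M s]/wt (negbTE ncs) andbF; apply/eqP; apply: contraNT ncs.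
  move=> nz; have := act_supp (d := 0) (K := (mrank N).-1) bN _ nz.
  rewrite quotient_mrank addn1 => -> // s'.
  by move=> /wt_supp ->; rewrite addn0 quotient_mrank.
have cN : #|s|.+2 = mrank N by rewrite quotient_mrank cs.
have wtM : wt M s = [forall S in s, flat M (val S)]%:R by rewrite /wt chs cs eqxx.
have [/forall_inP fs|nf] := boolP [forall S in s, flat N (val S)]; last first.
  rewrite wtM (_ : [forall S in s, flat M (val S)] = false); last first.
    apply/negbTE; apply: contra nf => /forall_inP H; apply/forall_inP => S Ss.
    by apply: quotient_flat; apply: H.
  rewrite /act big1 // => R _; rewrite /wt [X in _ && (_ && X)](_ : _ = false) ?andbF ?mulr0 //.
  apply/negbTE; apply: contra nf => /forall_inP H; apply/forall_inP => S Ss.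
  by apply: H; rewrite inE Ss orbT.
have [k [F [F' gp]]] := flag_gapP lN chs fs cN.
have [c [c0 cP]] := chain_interp (fun S : V => (g \in val S)%:R - (phi (val S))%:R) chs.
rewrite (actE bN c0 cP) (quotient_sum chs gp) //.
have [rF rF'] := (gap_rk gp, gap_rk' gp).
have bad : ~~ (~~ phi F && phi F') -> wt M s = 0.
  move=> np; rewrite wtM (_ : [forall S in s, flat M (val S)] = false) //.
  by apply: contraNF np => /forall_inP H; apply: quotient_chain_rk gp cs.
have [pF|pF] := boolP (phi F).
  rewrite bad ?pF // (phiS (gap_sub gp) pF) subrr sub0r big1 ?oppr0 //.
  by move=> R /and3P[_ FR _]; rewrite (phiS (proper_sub FR) pF) subrr.
have [pF'|pF'] := boolP (phi F'); last first.
  rewrite bad ?(negbTE pF') ?andbF // subrr sub0r big1 ?oppr0 //.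
  move=> R /and3P[_ _ RF']; case: (boolP (phi (val R))) => [pR|_]; last by rewrite subrr.
  by case/negP: pF'; apply: phiS pR; apply: proper_sub.
rewrite subr0.
have [[R0 btw0 pR0]|none] := pselect (exists2 R : V,
    [&& flat N (val R), F \proper val R & val R \proper F'] & phi (val R)).
  (* Two such flats have rank [k] in [M], their union has rank at least [k.+1], and their
     intersection contains [F], of rank [k]; this violates submodularity. *)
  have uniq R : [&& flat N (val R), F \proper val R & val R \proper F'] ->
      phi (val R) -> R = R0.
    move=> btw pR; apply/eqP; apply: contraT => neR.
    have /and3P[fR FR RF'] := btw; have /and3P[f0 F0 RF0] := btw0.
    have rR := between_rk (gap_flat gp) rF rF' fR FR RF'.
    have r0 := between_rk (gap_flat gp) rF rF' f0 F0 RF0.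
    have : (k.+1 < rk N (val R :|: val R0))%N.
      rewrite -rR; apply: flat_rk_lt => //; rewrite properEneq subsetUl andbT.
      apply: contra neR => /eqP e; apply/eqP; apply: val_inj; apply/eqP; rewrite eq_sym.
      have sub : val R0 \subset val R by rewrite e subsetUr.
      rewrite eqEproper sub /=; apply: contraTN isT => /(flat_rk_lt f0).
      by rewrite rR r0 ltnn.
    have : (rk M F <= rk M (val R :&: val R0))%N.
      by rewrite rk_mono // subsetI !proper_sub.
    have := rk_submod M (val R) (val R0).
    have pU : phi (val R :|: val R0) by apply: phiS pR; apply: subsetUl.
    move: rF rR r0; rewrite !rkN pR pR0 pU (negbTE pF); clear; lia.
  rewrite (bigD1 R0) //= pR0 big1 => [|R /andP[btw neR]]; last first.
    have [pR|_] := boolP (phi (val R)); last by rewrite subrr.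
    by rewrite (uniq R btw pR) eqxx in neR.
  rewrite subr0 addr0 subrr wtM (_ : [forall S in s, flat M (val S)] = false) //.
  apply/negP => /forall_inP fMs.
  (* [F] and the larger [R0] have the same rank in [M], so [F], a member of the extended flag, is
     not a flat of [M]. *)
  have fMF : flat M F by apply: ext_flat (gap_ext gp).
  have /and3P[f0 F0 RF0] := btw0.
  have r0 := between_rk (gap_flat gp) rF rF' f0 F0 RF0.
  have := flat_rk_lt fMF F0; move: rF r0; rewrite !rkN pR0 (negbTE pF); clear; lia.
rewrite big1 => [|R btw]; last first.
  have [pR|_] := boolP (phi (val R)); last by rewrite subrr.
  by case: none; exists R.
rewrite subr0 wtM (_ : [forall S in s, flat M (val S)] = true) //.
apply/forall_inP => T Ts; apply/flatP => x xT.
have nx : (rk N (val T) < rk N (x |: val T))%N by move/flatP: (fs T Ts); apply.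
(* Above the gap [phi] holds throughout, so both ranks rise together. Below it, adding [x] must not
   reach [phi]: for [x] in [F'] the closure of [x |: F] would be a flat in between satisfying [phi],
   and for [x] outside [F'] submodularity with [F'] would fail. *)
have [le|gt] := leqP (rk N (val T)) k; last first.
  have pT : phi (val T) by apply: phiS pF'; apply: (gap_ge gp Ts gt).
  have pxT : phi (x |: val T) by apply: phiS pT; apply: subsetUr.
  by move: nx; rewrite !rkN pT pxT; clear; lia.
have TF := gap_le gp Ts le.
have pT : phi (val T) = false by apply: contraNF pF; apply: phiS.
suff pxT : phi (x |: val T) = false by move: nx; rewrite !rkN pT pxT; clear; lia.
apply/negP => pxT.
have [xF'|xF'] := boolP (x \in F').
  have pxF : phi (x |: F) by apply: phiS pxT; apply: setUS.
  have [xF|xF] := boolP (x \in F).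
    by case/negP: pF; rewrite -(setUidPr (_ : [set x] \subset F)) // sub1set.
  have rU : rk N (x |: F) = (rk N F).+1.
    by apply/eqP; rewrite eqn_leq rk_setU1_le; move/flatP: (gap_flat gp); apply.
  have FA : F \proper cl N (x |: F).
    apply: proper_sub_trans (sub_cl _ _); apply/properP; split; first exact: subsetUr.
    by exists x; rewrite ?setU11.
  have AF' : cl N (x |: F) \proper F'.
    rewrite properEneq cl_sub_flat ?andbT //; last 2 first.
    - exact: gap_flat' gp.
    - by rewrite subUset sub1set xF' (gap_sub gp).
    by apply/eqP => E; move: rF'; rewrite -E rk_cl rU rF => /n_Sn.
  have [R0 R0E] := psubset_ex FA AF'.
  case: none; exists R0; rewrite R0E ?flat_cl ?FA //.
  by apply: phiS pxF; apply: sub_cl.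
have TF' : val T \subset F' := subset_trans TF (gap_sub gp).
have : (rk N F' < rk N (x |: F'))%N by move/flatP: (gap_flat' gp); apply.
have pxF' : phi (x |: F') by apply: phiS pF'; apply: subsetUr.
have := rk_submod M (x |: val T) F'.
rewrite -setUA (setUidPr TF').
have : (rk M (val T) <= rk M ((x |: val T) :&: F'))%N by rewrite rk_mono // subsetI subsetUr.
have := rk_setU1_le N (val T) x.
rewrite !rkN pxT pT pF' pxF'; clear; lia.
Qed.

End Quotient.

Section HiggsLift.
Variables (G : finType) (M : matroid G).

(** Also called elongation, the dual of truncation: the sets of nullity at most one become
    independent. *)
Definition lift_rk (A : {set G}) := minn #|A| (rk M A).+1.

Fact lift_rk_card A : (lift_rk A <= #|A|)%N.
Proof. exact: geq_minl. Qed.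

Fact lift_rk_mono (A B : {set G}) : A \subset B -> (lift_rk A <= lift_rk B)%N.
Proof.
move=> AB; have := subset_leq_card AB; have := rk_mono M AB.
by rewrite /lift_rk; lia.
Qed.

Lemma rk_nullity (A B : {set G}) : A \subset B -> (#|A| + rk M B <= #|B| + rk M A)%N.
Proof.
move=> AB; have := rk_submod M A (B :\: A); have := rk_card M (B :\: A).
have -> : A :|: B :\: A = B.
  by apply/setP => x; rewrite !inE; case: (boolP (x \in A)) => //= /(subsetP AB).
rewrite cardsD (setIidPr AB).
by have := subset_leq_card AB; lia.
Qed.

(** Submodularity of [rk M] and monotonicity of the nullity, by cases on which term attains each
    minimum. *)
Fact lift_rk_submod (A B : {set G}) :
  (lift_rk (A :|: B) + lift_rk (A :&: B) <= lift_rk A + lift_rk B)%N.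
Proof.
have := rk_submod M A B; have := cardsUI A B.
have := rk_nullity (subsetUl A B); have := rk_nullity (subsetUr A B).
have := rk_nullity (subsetIl A B); have := rk_nullity (subsetIr A B).
have := rk_card M A; have := rk_card M B.
have := rk_card M (A :&: B); have := rk_card M (A :|: B).
by rewrite /lift_rk; lia.
Qed.

Definition higgs_lift : matroid G := Matroid lift_rk_card lift_rk_mono lift_rk_submod.

Lemma higgs_lift_loopless : loopless M -> loopless higgs_lift.
Proof. by move=> lM; apply/forallP => x; rewrite /= /lift_rk cards1 loopless_rk1. Qed.

(** The rank drops exactly on the dependent sets, an up-set that contains the ground set as long as
    [M] is not free. *)
Lemma higgs_lift_wt g : loopless M -> (mrank M < #|G|)%N ->
  act (fun S : psubset G => (g \in val S)%:R - (rk M (val S) < #|val S|)%N%:R) (wt higgs_lift)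
  = wt M.
Proof.
move=> lM ltM; apply: (quotient_wt (phi := fun A => (rk M A < #|A|)%N)) => //.
- exact: higgs_lift_loopless.
- by move=> A /=; rewrite /lift_rk; have := rk_card M A; case: ltnP; lia.
- by move=> A B AB; have := rk_nullity AB; lia.
- by rewrite cardsT.
Qed.

Lemma higgs_lift_mrank : (mrank M < #|G|)%N -> mrank higgs_lift = (mrank M).+1.
Proof. by rewrite /mrank /= /lift_rk cardsT => /minn_idPr. Qed.

End HiggsLift.

(** * The degree map and the matroid classes *)

Section Degree.
Variable G : finType.
Local Notation V := (psubset G).
Local Notation N := #|psubset G|.
Local Notation P := {mpoly rat[#|psubset G|]}.
Implicit Types (S T R Q : V) (s : {set V}) (w : {set V} -> rat) (phi psi : V -> rat).
Implicit Types (p q : P) (m : 'X_{1..N}) (u v : chow G) (M : matroid G).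
Local Notation cls := (@chow_class G).

Lemma actpM p q w : balanced w -> actp (p * q) w = actp p (actp q w).
Proof.
move=> bw; have bq := balanced_actp q bw.
elim/mpoly_lin_ind: p => [|a m p IHp]; apply: funext => s; first by rewrite mul0r !actp0.
rewrite mulrDl -scalerAl !actp_comb IHp; congr (_ * _ + _).
elim/mnm_addU_ind: m s => [|i m IHm] s; first by rewrite mpolyX0 mul1r actp1.
rewrite mpolyXD -mulrA !actp_Xi //; congr (actx i _ s).
exact: funext.
Qed.

Lemma actp_lform1 phi w : balanced w -> actp (lform phi) w = act phi w.
Proof.
move=> bw; rewrite -[lform phi]mulr1 actp_lform //; congr (act phi _).
by apply: funext => s; rewrite actp1.
Qed.

Lemma actp_act phi p w : balanced w -> actp p (act phi w) = act phi (actp p w).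
Proof. by move=> bw; rewrite -actp_lform1 // -actpM // mulrC actp_lform. Qed.

Lemma xvar_homog S : (xvar S : P) \is 1.-homog.
Proof. by rewrite /xvar dhomogX /= mdeg1. Qed.

Lemma lform_homog phi : lform phi \is 1.-homog.
Proof. by apply: rpred_sum => S _; rewrite mul_mpolyC rpredZ // xvar_homog. Qed.

Fact free_rk_submod (A B : {set G}) : (#|A :|: B| + #|A :&: B| <= #|A| + #|B|)%N.
Proof. by rewrite cardsUI. Qed.

Definition free_matroid : matroid G :=
  @Matroid G (fun A => #|A|) (fun A => leqnn #|A|) (@subset_leq_card G) free_rk_submod.

Lemma free_loopless : loopless free_matroid.
Proof. by apply/forallP => x /=; rewrite cards1. Qed.

Lemma free_flat (A : {set G}) : flat free_matroid A.
Proof. by apply/flatP => x xA /=; rewrite cardsU1 xA. Qed.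

Let w0 := wt free_matroid.
Let bw0 : balanced w0. Proof. exact: wt_balanced free_loopless. Qed.

Lemma actp_cls p q w s : balanced w -> cls p = cls q -> actp p w s = actp q w s.
Proof.
by move=> bw /chow_class_eq/(actp_ideal s bw)/eqP; rewrite actpD actpN subr_eq0 => /eqP.
Qed.

Definition degree_fun u : rat := actp (repr u : P) w0 set0.

Lemma degree_fun_class p : degree_fun (cls p) = actp p w0 set0.
Proof. by apply: actp_cls; rewrite // chow_reprK. Qed.

Lemma degree_fun_comb a u v :
  degree_fun (chow_const G a * u + v) = a * degree_fun u + degree_fun v.
Proof.
rewrite -{1}[u]chow_reprK -{1}[v]chow_reprK -chow_classZ -chow_classD degree_fun_class.
by rewrite actp_comb.
Qed.

Lemma degree_fun_chain s : chainset s -> degree_fun (\prod_(S in s) xclass S) = w0 s.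
Proof. by move=> chs; rewrite -chow_class_prod degree_fun_class actp_chain. Qed.

(** For injectivity in top degree, every class [u] there is shown to be its degree times the top
    power of [beta]: this holds on complete chains, and they span. *)
Lemma chow_deg_spec : (0 < #|G|)%N -> is_degree_map (@chow_deg G).
Proof.
move=> G0; apply: (@classical_sets.xgetPex _ _ (@is_degree_map G)); exists degree_fun.
have /card_gt0P[g _] := G0.
have complete (s : {set V}) : chainset s -> #|s| = pdim G -> w0 s = 1.
  move=> chs cs; rewrite /w0 /wt chs cs /mrank /= cardsT prednK // eqxx.
  by have -> : [forall S in s, flat free_matroid (val S)] by apply/forall_inP => S _; apply: free_flat.
have complete1 l : is_chain (pdim G) l -> degree_fun (chain_class l) = 1.
  move=> chl; have [_ chs cs] := chain_seq_set chl.
  by rewrite (chain_class_set chl) degree_fun_chain ?complete.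
split=> //.
- exact: degree_fun_comb.
- move=> d _ dm [p [hp ->]]; rewrite degree_fun_class.
  apply: (actp_supp bw0 (K := pdim G)) hp _ _; last by rewrite cards0; apply/eqP.
  by move=> s /wt_supp ->; rewrite /mrank /= cardsT.
move=> _ [p [hp ->]] deg0.
suff : cls p = chow_const G (degree_fun (cls p)) * beta g ^+ pdim G.
  by rewrite deg0 chow_const0 mul0r.
have sp := chain_span_homog hp.
apply: (sp (fun u => u = chow_const G (degree_fun u) * beta g ^+ pdim G))
  => [|a u v {1}-> {1}->|s chs cs].
- by rewrite -chow_class0 degree_fun_class actp0 chow_const0 mul0r chow_class0.
- by rewrite degree_fun_comb chow_constD chow_constM mulrDl -mulrA.
have [l chl pl] := chain_set_seq chs; rewrite cs in chl.
rewrite degree_fun_chain // complete // chow_const1 mul1r.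
by rewrite -(complete_chain_beta g chl) /chain_class (perm_prod_chain _ pl).
Qed.

(** The conditions on a degree map determine it: it vanishes outside top degree, where complete
    chains span. *)
Lemma chow_degE p : (0 < #|G|)%N -> chow_deg (cls p) = actp p w0 set0.
Proof.
move=> G0; have [lin hom _ comp] := chow_deg_spec G0.
have deg0 : chow_deg (0 : chow G) = 0.
  have := lin (- 1) 0 0; rewrite mulr0 addr0 mulN1r addNr; exact.
elim/mpoly_lin_ind: p => [|a m p IHp]; first by rewrite actp0 chow_class0.
rewrite chow_classD chow_classZ lin IHp actp_comb; congr (_ * _ + _).
have hX : 'X_[m] \is [in rat[N], (mdeg m).-homog] by rewrite dhomogX.
have [dm|dm] := eqVneq (mdeg m) (pdim G); last first.
  rewrite (hom (mdeg m)); [|exact/eqP|by exists 'X_[m]].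
  rewrite (actp_supp bw0 (K := pdim G) _ hX) ?cards0 // => s /wt_supp ->.
  by rewrite /mrank /= cardsT.
rewrite -degree_fun_class; rewrite dm in hX.
have sp := chain_span_homog hX.
apply: (sp (fun u => chow_deg u = degree_fun u)) => [|b u v eu ev|s chs cs].
- by rewrite deg0 -chow_class0 degree_fun_class actp0.
- by rewrite lin degree_fun_comb eu ev.
have [l chl pl] := chain_set_seq chs; rewrite cs in chl.
rewrite -(perm_prod_chain _ pl) comp // -/(chain_class l) (chain_class_set chl).
have [_ chl' cl'] := chain_seq_set chl.
rewrite degree_fun_chain // /w0 /wt chl' cl' /mrank /= cardsT prednK // eqxx.
by have -> : [forall S in [set S in l], flat free_matroid (val S)]
  by apply/forall_inP => S _; apply: free_flat.
Qed.

Lemma mrank_gt0 M : loopless M -> (0 < #|G|)%N -> (0 < mrank M)%N.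
Proof. by move=> lM /card_gt0P[g _]; apply: (rk_gt0 (x := g) lM). Qed.

Lemma wt_free M : mrank M = #|G| -> wt M = w0.
Proof.
move=> rM; have rkE A : rk M A = #|A|.
  have := rk_nullity M (subsetT A); rewrite -/(mrank M) rM cardsT addnC leq_add2l.
  by move=> le; apply/eqP; rewrite eqn_leq rk_card.
apply: funext => s; rewrite /w0 /wt /mrank rkE /=; congr (nat_of_bool [&& _, _ & _])%:R.
apply: eq_forallb => S; congr (_ ==> _); rewrite free_flat; apply/flatP => x xS.
by rewrite !rkE cardsU1 xS.
Qed.

(** Each Higgs lift contributes one linear factor and raises the rank by one, until the free matroid
    is reached. *)
Lemma wt_matroid_poly M : (0 < #|G|)%N -> loopless M -> exists2 q,
  q \is (#|G| - mrank M).-homog & forall p, actp (q * p) w0 = actp p (wt M).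
Proof.
case/card_gt0P => g _ lM; have [k] := ubnP (#|G| - mrank M)%N.
elim: k M lM => // k IHk M lM lek.
have : (mrank M <= #|G|)%N by rewrite -cardsT rk_card.
rewrite leq_eqVlt => /predU1P[rM|ltM].
  exists 1; first by rewrite rM subnn; apply: dhomog1.
  by move=> p; rewrite mul1r (wt_free rM).
have lN := higgs_lift_loopless lM; have rN := higgs_lift_mrank ltM.
have [|q hq qP] := IHk _ lN; first by rewrite rN; lia.
set phi := fun S : V => (g \in val S)%:R - (rk M (val S) < #|val S|)%N%:R : rat.
exists (q * lform phi).
  have -> : (#|G| - mrank M = (#|G| - mrank (higgs_lift M)) + 1)%N by rewrite rN; lia.
  exact: dhomogM (lform_homog _).
move=> p; rewrite -mulrA qP actp_lform; last exact: wt_balanced.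
by rewrite -(higgs_lift_wt g lM ltM) actp_act //; apply: wt_balanced.
Qed.

(** The chosen class and the explicit one have the same pairing with monomials of chains, and these
    span the degree of [p]. *)
Lemma matroid_class_deg M p : (0 < #|G|)%N -> loopless M ->
  p \is (mrank M).-1.-homog ->
  chow_deg (matroid_class M * cls p) = actp p (wt M) set0.
Proof.
move=> G0 lM hp; have [q hq qP] := wt_matroid_poly G0 lM.
have rM : (mrank M).-1.+1 = mrank M by rewrite prednK ?mrank_gt0.
have bM := wt_balanced lM.
have wt_chain l : is_chain (mrank M).-1 l ->
    wt M [set S in l] = if all (fun S : V => flat M (val S)) l then 1 else 0.
  move=> chl; have [_ chs cs] := chain_seq_set chl.
  rewrite /wt chs cs rM eqxx /=.
  have -> : [forall S in [set S in l], flat M (val S)] = all (fun S : V => flat M (val S)) l.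
    apply/forall_inP/allP => H S Sl; first by apply: H; rewrite inE.
    by apply: H; rewrite inE in Sl.
  by case: all.
have : is_matroid_class M (matroid_class M).
  apply: (@classical_sets.xgetPex _ _ (@is_matroid_class G M)); exists (cls q); split.
    by exists q; split; rewrite // /pdim prednK.
  move=> l chl; have [_ chs _] := chain_seq_set chl.
  rewrite (chain_class_set chl) -chow_class_prod -chow_classM chow_degE // qP.
  by rewrite actp_chain ?wt_chain.
case=> _ mcP; have [lin _ _ _] := chow_deg_spec G0.
rewrite -qP -chow_degE // chow_classM.
have sp := chain_span_homog hp.
apply: (sp (fun u => chow_deg (matroid_class M * u) = chow_deg (cls q * u)))
  => [|a u v eu ev|s chs cs]; first by rewrite !mulr0.
  by rewrite !mulrDr ![_ * (chow_const G a * u)]mulrCA !lin eu ev.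
have [l chl pl] := chain_set_seq chs; rewrite cs in chl.
rewrite -(perm_prod_chain _ pl) mcP // -/(chain_class l) (chain_class_set chl).
have [_ chs' _] := chain_seq_set chl.
by rewrite -chow_class_prod -chow_classM chow_degE // qP actp_chain ?wt_chain.
Qed.

Definition Lfun (g : G) (k : nat) (S : V) : rat :=
  (minn k #|val S|)%:R - (if g \in val S then k%:R else 0).

Definition Lpoly (g : G) (i : nat) : P := lform (Lfun g ((pdim G).+1 - i)).

Lemma Lprod_homog (g : G) (a : nat -> nat) (r : seq nat) :
  \prod_(i <- r) Lpoly g i ^+ a i \is (\sum_(i <- r) a i).-homog.
Proof.
elim: r => [|i r IHr]; first by rewrite !big_nil; apply: dhomog1.
rewrite !big_cons; apply: dhomogM IHr.
by have := dhomogMn (a i) (lform_homog (Lfun g ((pdim G).+1 - i))); rewrite mul1n.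
Qed.

(** [Lclass] picks its own base point. Quantifying [g] before [M] and [a] lets all numbers on one
    ground set use the same polynomials. *)
Lemma mixed_eulerianE : (0 < #|G|)%N -> exists g : G, forall M (a : nat -> nat),
  loopless M -> (\sum_(1 <= i < (pdim G).+1) a i = (mrank M).-1)%N ->
  mixed_eulerian M a = actp (\prod_(1 <= i < (pdim G).+1) Lpoly g i ^+ a i) (wt M) set0.
Proof.
move=> G0; rewrite /mixed_eulerian /Lclass; case: pickP => [g _|no]; last first.
  by have /card_gt0P[g _] := G0; have := no g.
exists g => M a lM sa; rewrite -matroid_class_deg //.
  by rewrite chow_class_prod; under [in RHS]eq_bigr do rewrite chow_classX.
by rewrite -sa; apply: Lprod_homog.
Qed.

End Degree.

(** * Restriction to the star of a set *)

Section Star.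
(** The set appears both as [F] and as the ray [S], so that the smaller ground set is literally that
    of [contract M F]. *)
Variables (G : finType) (F : {set G}) (S : psubset G).
Hypothesis SF : val S = F.
Local Notation V := (psubset G).
Local Notation G' := {x : G | x \notin F}.
Local Notation V' := (psubset G').
Implicit Types (w : {set V} -> rat) (t : {set V'}) (T : V') (R : V) (c : G' -> rat).

Definition star_set (A : {set G'}) : {set G} := val @: A :|: F.

Lemma star_setD (A : {set G'}) : star_set A :\: F = val @: A.
Proof.
apply/setP => x; rewrite !inE; case: (boolP (x \in F)) => [xS|_]; last by rewrite orbF.
by apply/esym/negbTE; apply: contraL xS => /imsetP[y _ ->]; exact: (valP y).
Qed.

Lemma star_setS (A B : {set G'}) : (star_set A \subset star_set B) = (A \subset B).
Proof.
apply/idP/idP => [sAB|AB]; last by rewrite setSU // imsetS.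
apply/subsetP => x xA; have : val x \in star_set B :\: F.
  by rewrite inE (valP x) (subsetP sAB) // inE imset_f.
by rewrite star_setD => /imsetP[y yB /val_inj->].
Qed.

Fact star_proper T : (star_set (val T) != set0) && (star_set (val T) \proper [set: G]).
Proof.
have [e] := psubset_neq0 S; rewrite SF => eS; have [h hT] := psubset_neqT T.
apply/andP; split; first by apply/set0Pn; exists e; rewrite inE eS orbT.
apply/properP; split; [exact: subsetT | exists (val h) => //].
rewrite inE negb_or (valP h) andbT; apply: contra hT => /imsetP[y yT /val_inj->].
exact: yT.
Qed.

Definition star T : V := Sub (star_set (val T)) (star_proper T).

Lemma val_star T : val (star T) = star_set (val T).
Proof. exact: SubK. Qed.

Lemma star_inj : injective star.
Proof.
move=> T T' /(congr1 val); rewrite !val_star => e; apply/val_inj/eqP.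
by rewrite eqEsubset -!star_setS e !subxx.
Qed.

Lemma cmp_star T T' : cmp (star T) (star T') = cmp T T'.
Proof. by rewrite /cmp !val_star !star_setS. Qed.

Lemma star_above T : F \proper val (star T).
Proof.
rewrite val_star; have [x xT] := psubset_neq0 T.
apply/properP; split; first exact: subsetUr.
by exists (val x); [rewrite inE imset_f | exact: (valP x)].
Qed.

Lemma above_star R : F \proper val R -> exists T, R = star T.
Proof.
case/properP => SR [e eR eS]; pose A := [set x : G' | val x \in val R].
have EA : star_set A = val R.
  apply/setP => x; rewrite inE; apply/orP/idP => [[/imsetP[y + ->]|]|xR].
  - by rewrite inE.
  - exact: (subsetP SR).
  have [|xS] := boolP (x \in F); [by right | left].
  by apply/imsetP; exists (Sub x xS); rewrite ?inE SubK.
have pA : (A != set0) && (A \proper [set: G']).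
  have [h hR] := psubset_neqT R.
  have hS : h \notin F by apply: contra hR; apply: (subsetP SR).
  apply/andP; split; first by apply/set0Pn; exists (Sub e eS); rewrite inE SubK.
  by apply/properP; split; [exact: subsetT | exists (Sub h hS); rewrite ?inE ?SubK].
by exists (Sub A pA); apply: val_inj; rewrite val_star SubK EA.
Qed.

(** The star of [S] is a product of the permutohedral fans of [F] and of its complement; [res] reads
    [w] at the origin of the first factor. *)
Definition res w t : rat := w (S |: star @: t).

Lemma res_chain t : chainset (S |: star @: t) = chainset t.
Proof.
have abv T : T \in t -> star T \in S |: star @: t by move=> Tt; rewrite inE imset_f ?orbT.
apply/chainsetP/chainsetP => H.
  by move=> T T' Tt T't; rewrite -cmp_star H ?abv.
move=> R R'; rewrite !inE => /predU1P[->|/imsetP[T Tt ->]] /predU1P[->|/imsetP[T' T't ->]].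
- exact: cmpxx.
- by rewrite /cmp SF (proper_sub (star_above T')).
- by rewrite cmpC /cmp SF (proper_sub (star_above T)).
- by rewrite cmp_star H.
Qed.

Lemma res_sum w t (f : V -> rat) : balanced w ->
  (forall R, val R \subset F -> f R = 0) ->
  \sum_R f R * w (R |: (S |: star @: t)) = \sum_T f (star T) * res w (T |: t).
Proof.
move=> bw f0; rewrite (bigID (fun R : V => R \in star @: [set: V'])) /=.
rewrite [X in _ + X]big1 ?addr0 => [|R nR]; last first.
  have [RS|nRS] := boolP (val R \subset F); first by rewrite f0 ?mul0r.
  rewrite (balanced_chain bw) ?mulr0 //; apply/negP => /chainsetP/(_ R S).
  rewrite !inE !eqxx !orbT /cmp SF (negbTE nRS) => /(_ isT isT) /= SR.
  have : F \proper val R by rewrite properE SR.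
  by case/above_star => T e; rewrite e imset_f in nR.
rewrite big_imset /=; last by move=> ? ? _ _; apply: star_inj.
apply: eq_big => [T|T _]; first by rewrite inE.
by rewrite /res imsetU1 setUCA.
Qed.

Definition star_ext c (e : G) : rat := oapp c 0 (insub e).

Lemma star_ext_out c (A : {set G}) : A \subset F -> linf (star_ext c) A = 0.
Proof.
move=> AS; rewrite /linf big1 // => e /(subsetP AS) eS.
by rewrite /star_ext insubN // eS.
Qed.

Lemma star_ext_set c (A : {set G'}) : linf (star_ext c) (star_set A) = linf c A.
Proof.
rewrite (linf_sum _ (subsetUr _ _ : F \subset star_set A)) star_setD.
rewrite star_ext_out // add0r /linf big_imset /=; last by move=> ? ? _ _; apply: val_inj.
by apply: eq_bigr => x _; rewrite /star_ext valK.
Qed.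

Lemma star_ext_star c T : linf (star_ext c) (val (star T)) = linf c (val T).
Proof. by rewrite val_star star_ext_set. Qed.

Lemma star_ext_total c : \sum_e star_ext c e = \sum_x c x.
Proof.
rewrite -!linfT -star_ext_set; congr linf; apply/setP => e; rewrite !inE.
apply/esym/orP; have [|eS] := boolP (e \in F); [by right | left].
by apply/imsetP; exists (Sub e eS); rewrite ?inE ?SubK.
Qed.

Lemma res_balanced w : balanced w -> balanced (res w).
Proof.
move=> bw; split=> [t /(proj1 bw)|t c c0 cP]; first by rewrite res_chain.
have := proj2 bw (S |: star @: t) (star_ext c).
rewrite star_ext_total c0 => /(_ erefl).
rewrite (res_sum _ (f := fun R => linf (star_ext c) (val R))) //; last first.
  by move=> R; apply: star_ext_out.
under eq_bigr do rewrite star_ext_star.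
apply=> R; rewrite !inE => /predU1P[->|/imsetP[T Tt ->]]; first by rewrite SF star_ext_out.
by rewrite star_ext_star cP.
Qed.

(** Such a [phi] lives on the second factor of the star: a correction found on the complement of
    [F], extended by zero, is a correction on the star. *)
Lemma res_act phi w : balanced w -> (forall R, val R \subset F -> phi R = 0) ->
  res (act phi w) = act (fun T => phi (star T)) (res w).
Proof.
move=> bw phi0; apply: funext => t; have bR := res_balanced bw.
have [cht|nch] := boolP (chainset t); last first.
  by rewrite /res !act_chain // res_chain.
have [c [c0 cP]] := chain_interp (fun T => phi (star T)) cht.
rewrite (actE bR c0 cP) {1}/res (actE (c := star_ext c) bw).
- rewrite (res_sum _ (f := fun R => phi R - linf (star_ext c) (val R))) //; last first.
    by move=> R RS; rewrite phi0 // star_ext_out // subrr.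
  by under eq_bigr do rewrite star_ext_star.
- by rewrite star_ext_total.
move=> R; rewrite !inE => /predU1P[->|/imsetP[T Tt ->]].
  by rewrite SF star_ext_out // phi0 // SF.
by rewrite star_ext_star cP.
Qed.

Lemma linf_mem (A B : {set G}) : linf (fun e => (e \in A)%:R) B = #|B :&: A|%:R.
Proof.
rewrite /linf -sum1_card natr_sum (bigID (mem A)) /= addrC big1 ?add0r.
  by apply: eq_big => [e|e /andP[_ ->]] //; rewrite inE.
by move=> e /andP[_ /negbTE->].
Qed.

Lemma res_Lfun (g : G) (g' : G') k w : balanced w -> (#|F| <= k)%N ->
  res (act (Lfun g k) w) = act (Lfun g' (k - #|F|)) (res w).
Proof.
move=> bw sk.
(* Chosen with total zero so that the difference is 0 on subsets of [F], where [min(k,|R|)] is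
   [|R|], while above [F] it becomes the function with parameter [k - #|F|] and base point [g']. *)
pose c e : rat := (e \in F)%:R + (k - #|F|)%:R * (e == val g')%:R - k%:R * (e == g)%:R.
have cE A : linf c A = #|A :&: F|%:R + (k - #|F|)%:R * (val g' \in A)%:R - k%:R * (g \in A)%:R.
  by rewrite linfB /linf big_split /= -!/(linf _ _) linf_mem !linfZ !linf1.
pose phi R : rat := Lfun g k R - linf c (val R).
have phiE R : phi R = (minn k #|val R|)%:R - #|val R :&: F|%:R
    - (k - #|F|)%:R * (val g' \in val R)%:R.
  rewrite /phi /Lfun cE; case: (g \in val R); rewrite ?mulr1 ?mulr0; ring.
have -> : act (Lfun g k) w = act phi w.
  apply: funext => s; apply: (act_eqlin (c := c)) => //; last by move=> R; rewrite /phi subrK.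
  by rewrite -linfT cE setTI !inE !mulr1 -natrD subnKC // subrr.
rewrite res_act //; last first.
  move=> R RS; rewrite phiE (setIidPl RS) (_ : val g' \in val R = false); last first.
    by apply/negP => /(subsetP RS); apply/negP; exact: (valP g').
  by rewrite mulr0 subr0 (minn_idPr _) ?subrr // (leq_trans (subset_leq_card RS)).
apply: eq_act => T; rewrite phiE val_star /Lfun.
rewrite (setIidPr (subsetUr _ _)) {2}/star_set inE (negbTE (valP g')) orbF.
have -> : (val g' \in [set val x | x in val T]) = (g' \in val T).
  by apply/imsetP/idP => [[x xT /val_inj->]|gT] //; exists g'.
have -> : #|star_set (val T)| = (#|val T| + #|F|)%N.
  have := cardsID (F) (star_set (val T)).
  rewrite star_setD (setIidPr (subsetUr _ _)) card_imset; last exact: val_inj.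
  by rewrite addnC => ->.
have -> : minn k (#|val T| + #|F|) = (minn (k - #|F|) #|val T| + #|F|)%N by lia.
by rewrite natrD addrK; case: (g' \in val T); rewrite ?mulr1 ?mulr0.
Qed.

(** On sets [R] comparable with [F] the value [min(|F|,|R|)] is [|R :&: F|], so the function is
    linear on the star of [S]. *)
Lemma act_Lfun_card g w (s : {set V}) : balanced w -> S \in s ->
  act (Lfun g #|F|) w s = 0.
Proof.
move=> bw Ss; have [chs|nch] := boolP (chainset s); last by rewrite act_chain.
pose c e : rat := (e \in F)%:R - #|F|%:R * (e == g)%:R.
have cE A : linf c A = #|A :&: F|%:R - #|F|%:R * (g \in A)%:R.
  by rewrite linfB linf_mem linfZ linf1.
have cP R : cmp R S -> linf c (val R) = Lfun g #|F| R.
  rewrite cE /Lfun /cmp SF => H; congr (_%:R - _); last first.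
    by case: (g \in _); rewrite ?mulr1 ?mulr0.
  case/orP: H => sub; have := subset_leq_card sub; rewrite ?(setIidPl sub) ?(setIidPr sub); lia.
rewrite (actE (c := c) bw).
- rewrite big1 // => R _; have [RS|nRS] := boolP (cmp R S); first by rewrite cP // subrr mul0r.
  rewrite (balanced_chain bw) ?mulr0 //; apply: contra nRS => /chainsetP/(_ R S).
  by rewrite !inE eqxx Ss orbT; apply.
- by rewrite -linfT cE setTI inE mulr1 subrr.
- by move=> R Rs; apply: cP; apply: (chainsetP _ chs).
Qed.

End Star.

(** * Powers of the hyperplane class *)

Section Truncation.
Variables (G : finType) (M : matroid G).
Local Notation V := (psubset G).
Implicit Types (S T R : V) (s t u : {set V}) (A B : {set G}).
Hypothesis lM : loopless M.

Lemma flat_chain_card s l h : chainset s -> {in s, forall S, flat M (val S)} ->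
  {in s, forall S, l < rk M (val S) <= h}%N -> (#|s| <= h - l)%N.
Proof.
move=> chs fs bs.
pose f S : 'I_(h - l).+1 := inord (rk M (val S) - l.+1).
have fE S : S \in s -> f S = (rk M (val S) - l.+1)%N :> nat.
  by move=> /bs /andP[h1 h2]; rewrite inordK //; move: h1 h2; clear; lia.
have injf : {in s &, injective f}.
  move=> S T Ss Ts /(congr1 (@nat_of_ord _)); rewrite !fE // => e.
  suff rST : rk M (val S) = rk M (val T) by apply: (flat_chain_inj chs fs).
  by have := bs _ Ss; have := bs _ Ts; move: e; clear; lia.
rewrite -(card_in_imset injf).
have : f @: s \subset [set~ ord_max].
  apply/subsetP => i /imsetP[S Ss ->]; rewrite !inE -val_eqE /= -/(nat_of_ord _) fE //.
  by have := bs _ Ss; lia.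
by move/subset_leq_card; rewrite cardsC1 card_ord.
Qed.

Lemma chain_top t A : chainset t -> A != set0 -> {in t, forall T, val T \proper A} ->
  exists B, [/\ B \proper A, {in t, forall T, val T \subset B} & B = set0 \/ exists2 T, T \in t & B = val T].
Proof.
move=> /chainsetP cht A0 tA; have [->|[T0 T0t]] := set_0Vmem t.
  exists set0; split; [by rewrite proper0 | by move=> T; rewrite inE | by left].
case: (@arg_maxnP _ T0 (mem t) (fun T : V => #|val T|) T0t) => T Tt maxT.
exists (val T); split; [exact: tA | | by right; exists T].
move=> T' T't; have /orP[//|TT'] := cht _ _ T't Tt.
by have /eqP -> : val T == val T' by rewrite eqEcard TT'; apply: maxT.
Qed.

(** Up to a linear function, [phi] is 0 above [A0] and the indicator of a freely chosen [g] in [A0]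
    strictly below it: the hyperplane class of the restriction to [A0]. The ground set as [A0]
    serves [j = 1], a flat [F] serves the stars. *)
Variables (A0 : {set G}) (phi : V -> rat) (s : {set V}).
Hypothesis A0n : A0 != set0.
Hypothesis fA0 : flat M A0.
Hypothesis A0s : forall S, S \in s -> A0 \subset val S.
Hypothesis A0in : A0 = [set: G] \/ exists2 S, S \in s & val S = A0.
Hypothesis phiP : forall g, g \in A0 -> exists2 c : G -> rat, \sum_e c e = 0 &
  forall R, (A0 \subset val R -> phi R = linf c (val R)) /\
            (val R \proper A0 -> phi R = linf c (val R) + (g \in val R)%:R).

(* [t] consists of the lowest proper flats of a flag below [A0], with exactly [b] flats missing
   between [t] and [A0], and [s] is saturated above [A0]. *)
Definition tcond (b : nat) t :=
  [&& chainset (t :|: s), [forall S in t :|: s, flat M (val S)],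
      #|t| + b.+1 == rk M A0, [forall T in t, rk M (val T) <= #|t|] &
      #|s| + rk M A0 == mrank M]%N.

Lemma tcondP b t : reflect
  [/\ chainset (t :|: s), {in t :|: s, forall S, flat M (val S)},
      (#|t| + b.+1)%N = rk M A0, {in t, forall T, rk M (val T) <= #|t|}%N &
      (#|s| + rk M A0)%N = mrank M] (tcond b t).
Proof.
apply: (iffP and5P).
  by move=> [h1 /forall_inP h2 /eqP h3 /forall_inP h4 /eqP h5].
move=> [h1 h2 h3 h4 h5]; split=> //; first exact/forall_inP.
- exact/eqP.
- exact/forall_inP.
- exact/eqP.
Qed.

(** A chain of flats has at most [rk M A0 - 1] members strictly below [A0] and at most
    [mrank M - rk M A0] members containing it; a complete flag attains both bounds. *)
Lemma truncation_wt0 t : {in t, forall T, val T \proper A0} ->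
  wt M (t :|: s) = (tcond 0 t)%:R.
Proof.
move=> tA; rewrite /wt; congr (nat_of_bool _)%:R.
have dis : #|t :|: s| = (#|t| + #|s|)%N.
  rewrite cardsU (_ : t :&: s = set0) ?cards0 ?subn0 //; apply/setP => T; rewrite !inE.
  by apply/negP => /andP[/tA TA /A0s/(proper_sub_trans TA)]; rewrite properxx.
rewrite dis; apply/and3P/tcondP => [[ch /eqP ct /forall_inP fl]|[ch fl e1 _ e2]]; last first.
  by split=> //; [move: e1 e2; clear; lia | exact/forall_inP].
have fl' : {in t :|: s, forall S, flat M (val S)} by [].
have tb : {in t, forall T, 0 < rk M (val T) <= (rk M A0).-1}%N.
  move=> T Tt; have fT : flat M (val T) by apply: fl; rewrite inE Tt.
  have := flat_rk_bounds lM fT; have := flat_rk_lt fT (tA T Tt).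
  by clear; lia.
have ct' : (#|t| <= (rk M A0).-1)%N.
  rewrite -[X in (_ <= X)%N]subn0; apply: flat_chain_card tb.
    by apply: chainsetS ch; apply: subsetUl.
  by move=> T Tt; apply: fl; rewrite inE Tt.
have rA : (0 < rk M A0)%N by case/set0Pn: A0n => x xA; apply: rk_gt0 xA.
have cs' : (#|s| <= (mrank M).-1 - (rk M A0).-1)%N.
  apply: flat_chain_card.
  - by apply: chainsetS ch; apply: subsetUr.
  - by move=> S Ss; apply: fl; rewrite inE Ss orbT.
  move=> S Ss; have fS : flat M (val S) by apply: fl; rewrite inE Ss orbT.
  have := flat_rk_bounds lM fS; have := rk_mono M (A0s Ss).
  by move: rA; clear; lia.
have e : #|t| = (rk M A0).-1 /\ (#|s| + rk M A0)%N = mrank M.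
  by move: ct ct' cs' rA (rk_le_mrank M A0); clear; lia.
split=> //; [by move: e.1 rA; clear; lia | | exact: e.2].
by move=> T /tb /andP[_]; rewrite e.1.
Qed.

(** [R] contains [g] and no member of [t] does, so [R] lies strictly above [t]; its rank is at most
    [#|t|.+1], which bounds the ranks in [t] by [#|t|]. *)
Lemma tcond_step b t g R : {in t, forall T, val T \proper A0} -> {in t, forall T, g \notin val T} ->
  g \in val R -> tcond b (R |: t) -> tcond b.+1 t.
Proof.
move=> tA gt gR /tcondP[ch fl e1 rT e2].
have Rt : R \notin t by apply/negP => /gt; rewrite gR.
rewrite cardsU1 Rt add1n in e1 rT.
have sub : t :|: s \subset R |: t :|: s by rewrite -setUA subsetUr.
apply/tcondP; split=> //.
- exact: chainsetS ch.
- by move=> S St; apply: fl; apply: (subsetP sub).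
- by move: e1; clear; lia.
move=> T Tt.
have Tin : T \in R |: t :|: s by rewrite !inE Tt orbT.
have Rin : R \in R |: t :|: s by rewrite !inE eqxx.
have TR : val T \proper val R.
  have /orP[TR|RT] := chainsetP _ ch _ _ Tin Rin.
    by apply/properP; split=> //; exists g; rewrite ?gR ?gt.
  by have := gt _ Tt; rewrite (subsetP RT _ gR).
have := flat_rk_lt (fl _ Tin) TR; have := rT R (setU11 _ _); clear; lia.
Qed.

(** The added flat has rank at most [#|t|.+1] and contains [g] and [B], of rank [#|t|]; so it is the
    closure of [g |: B]. *)
Lemma tcond_unique b t g B : {in t, forall T, val T \proper A0} -> g \in A0 -> g \notin B ->
  B \proper A0 ->
  {in t, forall T, val T \subset B} -> (B = set0 \/ exists2 T, T \in t & B = val T) ->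
  tcond b.+1 t -> exists R0, [/\ val R0 \proper A0, g \in val R0, tcond b (R0 |: t) &
    forall R, g \in val R -> tcond b (R |: t) -> R = R0].
Proof.
move=> tA gA gB BA tB Bt /tcondP[ch fl e1 rT e2].
have fB : flat M B.
  by case: Bt => [->|[T Tt ->]]; [apply: flat_set0 | apply: fl; rewrite inE Tt].
have rB : rk M B = #|t|.
  apply/eqP; rewrite eqn_leq; apply/andP; split.
    by case: Bt => [->|[T Tt ->]]; [rewrite rk_set0 | apply: rT].
  rewrite -[X in (_ <= X)%N]subn0; apply: flat_chain_card.
  - by apply: chainsetS ch; apply: subsetUl.
  - by move=> T Tt; apply: fl; rewrite inE Tt.
  move=> T Tt; rewrite (rk_mono M (tB _ Tt)) andbT.
  by have [x xT] := psubset_neq0 T; apply: rk_gt0 xT.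
have rU : rk M (g |: B) = #|t|.+1.
  by rewrite -rB; apply/eqP; rewrite eqn_leq rk_setU1_le; move/flatP: fB; apply.
have BR : B \proper cl M (g |: B).
  apply: proper_sub_trans (sub_cl _ _); apply/properP; split; first exact: subsetUr.
  by exists g; rewrite ?setU11.
have RA : cl M (g |: B) \proper A0.
  rewrite properEneq cl_sub_flat ?andbT //; last by rewrite subUset sub1set gA proper_sub.
  by apply/eqP => e; move: e1; rewrite -e rk_cl rU; clear; lia.
have [R0 R0E] := psubset_ex BR RA.
have gR0 : g \in val R0 by rewrite R0E (subsetP (sub_cl _ _)) // setU11.
have gt T : T \in t -> g \notin val T by move=> Tt; apply: contra gB; apply/subsetP/tB.
have nt R : g \in val R -> R \notin t by move=> gR; apply/negP => /gt; rewrite gR.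
exists R0; split=> //; first by rewrite R0E.
  apply/tcondP; rewrite cardsU1 nt // add1n; split=> //.
  - have cR0 T : T \in t :|: s -> cmp R0 T.
      rewrite inE => /orP[/tB TB|/A0s AS]; rewrite /cmp R0E.
        by rewrite (subset_trans TB) ?orbT // proper_sub.
      by rewrite (subset_trans (proper_sub RA)).
    apply/chainsetP => T T'; rewrite -setUA !(in_setU1 _ _ (t :|: s)).
    move=> /predU1P[->|Tt] /predU1P[->|T't].
    + exact: cmpxx.
    + exact: cR0.
    + by rewrite cmpC cR0.
    + exact: (chainsetP _ ch).
  - move=> T; rewrite -setUA in_setU1 => /predU1P[->|/fl //].
    by rewrite R0E flat_cl.
  - by move: e1; clear; lia.
  move=> T; rewrite in_setU1 => /predU1P[->|/rT /leqW //].
  by rewrite R0E rk_cl rU.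
move=> R gR /tcondP[chR flR _ rR _].
have fR : flat M (val R) by apply: flR; rewrite !inE eqxx.
rewrite cardsU1 nt // add1n in rR.
have sBR : B \subset val R.
  case: Bt => [->|[T Tt eT]]; first exact: sub0set.
  have /orP[|sub] : cmp T R by apply: (chainsetP _ chR); rewrite !inE ?eqxx ?Tt ?orbT.
    by rewrite eT.
  by have := gt _ Tt; rewrite (subsetP sub _ gR).
have sub : cl M (g |: B) \subset val R by apply: cl_sub_flat; rewrite // subUset sub1set gR.
apply/val_inj/eqP; rewrite R0E eq_sym; apply: contraT => ne.
have : cl M (g |: B) \proper val R by rewrite properEneq ne.
move/(flat_rk_lt (flat_cl _ _)); rewrite rk_cl rU.
by have := rR R (setU11 _ _); clear; lia.
Qed.

(** Each application of [phi] removes the highest remaining flat below [A0]. With [g] taken in [A0]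
    outside the largest member of [t], the corrected function is the indicator of [g] below [A0],
    and the divisor counts the flats through [g] that extend [t]. *)
Lemma truncation_wt b t : {in t, forall T, val T \proper A0} ->
  iter b (act phi) (wt M) (t :|: s) = (tcond b t)%:R.
Proof.
elim: b t => [|b IHb] t tA; first exact: truncation_wt0.
have bw : balanced (iter b (act phi) (wt M)) by apply/balanced_iter/wt_balanced.
rewrite iterS; have [ch|nch] := boolP (chainset (t :|: s)); last first.
  by rewrite act_chain // /tcond (negbTE nch).
have cht : chainset t by apply: chainsetS ch; apply: subsetUl.
have [B [BA tB Bt]] := chain_top cht A0n tA.
have [_ [g gA gB]] := properP BA.
have gt : {in t, forall T, g \notin val T}.
  by move=> T Tt; apply: contra gB; apply/subsetP/tB.
have [c c0 cP] := phiP gA.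
rewrite (actE (c := c) bw) //; last first.
  move=> T; rewrite inE => /orP[Tt|/A0s AT]; last by rewrite (cP T).1.
  by rewrite (cP T).2 ?tA // (negbTE (gt _ Tt)) addr0.
have E R : (phi R - linf c (val R)) * iter b (act phi) (wt M) (R |: (t :|: s)) =
    [&& val R \proper A0, g \in val R & tcond b (R |: t)]%:R.
  have [chR|nR] := boolP (chainset (R |: (t :|: s))); last first.
    by rewrite (balanced_chain bw) // mulr0 /tcond -setUA (negbTE nR) !andbF.
  have [RA|nRA] := boolP (val R \proper A0).
    rewrite (cP R).2 // addrAC subrr add0r setUA IHb.
      by case: (g \in val R); rewrite ?mul1r ?mul0r.
    by move=> T; rewrite in_setU1 => /predU1P[->|/tA].
  rewrite (cP R).1 ?subrr ?mul0r //.
  case: A0in => [AT|[S Ss SE]].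
    case/negP: nRA; rewrite AT; have [h hR] := psubset_neqT R.
    by apply/properP; split; [apply: subsetT | exists h].
  have /orP[RS|] : cmp R S by apply: (chainsetP _ chR); rewrite !inE ?eqxx ?Ss ?orbT.
    by move: nRA; rewrite -SE properEneq RS andbT negbK => /eqP->.
  by rewrite SE.
under eq_bigr do rewrite E.
have [tc|ntc] := boolP (tcond b.+1 t).
  have [R0 [R0A gR0 tR0 uR0]] := tcond_unique tA gA gB BA tB Bt tc.
  rewrite (bigD1 R0) //= R0A gR0 tR0 big1 ?addr0 // => R neR.
  case: and3P => // -[_ gR tR]; by rewrite (uR0 R gR tR) eqxx in neR.
rewrite big1 // => R _; case: and3P => // -[_ gR tR].
by case/negP: ntc; exact: (tcond_step tA gt gR tR).
Qed.

End Truncation.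

(** * The classes [L] as hyperplane classes of restrictions *)

Section LTruncation.
Variables (G : finType) (M : matroid G).
Local Notation V := (psubset G).
Hypothesis lM : loopless M.

Lemma Lfun_truncation (g g1 : G) (A0 : {set G}) : g1 \in A0 ->
  exists2 c : G -> rat, \sum_e c e = 0 &
  forall R : V, (A0 \subset val R -> Lfun g #|A0|.-1 R = linf c (val R)) /\
    (val R \proper A0 -> Lfun g #|A0|.-1 R = linf c (val R) + (g1 \in val R)%:R).
Proof.
move=> g1A; have nA0 : (0 < #|A0|)%N by rewrite (cardD1 g1) g1A.
(* Strictly below [A0] the minimum is [|R|], above it is [|A0| - 1]. Subtracting the indicator of
   [g1] from [|R :&: A0|] is exact above [A0] and makes the total zero. *)
pose c e : rat := (e \in A0)%:R - (#|A0|.-1%:R * (e == g)%:R + (e == g1)%:R).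
have cE A : linf c A = #|A :&: A0|%:R - (#|A0|.-1%:R * (g \in A)%:R + (g1 \in A)%:R).
  by rewrite linfB linf_mem linfD !linf1.
have n1 : #|A0|%:R = #|A0|.-1%:R + 1 :> rat by rewrite natr1 prednK.
exists c => [|R].
  by rewrite -linfT cE setTI !inE mulr1 n1 subrr.
split=> sub; rewrite /Lfun cE.
  rewrite (setIidPr sub) (subsetP sub _ g1A) (minn_idPl _); last first.
    by apply: leq_trans (leq_pred _) _; apply: subset_leq_card.
  by rewrite n1; case: (g \in val R) => /=; ring.
rewrite (setIidPl (proper_sub sub)) (minn_idPr _); last first.
  by have := proper_card sub; move: nA0; clear; lia.
by case: (g \in val R) => /=; ring.
Qed.

Lemma contract_mrank (F : {set G}) : mrank (contract M F) = (mrank M - rk M F)%N.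
Proof.
rewrite /mrank /= /contract_rk; congr (rk M _ - _)%N; apply/setP => x; rewrite !inE.
apply/orP; have [|xF] := boolP (x \in F); [by right | left].
by apply/imsetP; exists (Sub x xF); rewrite ?inE ?SubK.
Qed.

Lemma flat_star_set (F : {set G}) (A : {set {x : G | x \notin F}}) :
  flat M (star_set A) = flat (contract M F) A.
Proof.
have ltE x : (rk (contract M F) A < rk (contract M F) (x |: A))%N
    = (rk M (star_set A) < rk M (val x |: star_set A))%N.
  rewrite /= /contract_rk imsetU1 -setUA -/(star_set A).
  by rewrite ltn_sub2rE // rk_mono // subsetUr.
apply/flatP/flatP => H x xA.
  by rewrite ltE; apply: H; rewrite inE negb_or (valP x) andbT mem_imset //; exact: val_inj.
have xF : x \notin F by apply: contra xA => xF; rewrite inE xF orbT.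
have xA' : Sub x xF \notin A.
  by apply: contra xA => xA; rewrite inE; apply/orP; left; apply/imsetP; exists (Sub x xF); rewrite ?SubK.
by have := H _ xA'; rewrite ltE SubK.
Qed.

(* The power of [L] is concentrated on [M | F], where it is the hyperplane class; hence it
   contributes 1 if its exponent is [rk F - 1], and 0 otherwise. *)
Lemma res_truncation (F : {set G}) (S : V) (SF : val S = F) g b : flat M F ->
  res SF (iter b (act (Lfun g #|F|.-1)) (wt M)) =
  fun t => (b.+1 == rk M F)%:R * wt (contract M F) t.
Proof.
move=> fF; apply: funext => t; have F0 : F != set0 by rewrite -SF; case: (S) => ? /= /andP[].
rewrite /res -[S |: _]set0U (truncation_wt lM F0 fF) //; last 4 first.
- move=> R; rewrite !inE => /predU1P[->|/imsetP[T _ ->]]; first by rewrite SF.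
  exact/proper_sub/star_above.
- by right; exists S; rewrite ?setU11.
- by move=> g1; apply: Lfun_truncation.
- by move=> T; rewrite inE.
rewrite -natrM mulnb /tcond /wt; congr (nat_of_bool _)%:R.
rewrite set0U res_chain cards0 add0n; have [_|_] := eqVneq b.+1 (rk M F); last by rewrite !andbF.
have -> : [forall T in set0, rk M (val (T : V)) <= 0]%N by apply/forall_inP => T; rewrite inE.
have nS : S \notin star SF @: t.
  by apply/negP => /imsetP[T _ E]; have := star_above SF T; rewrite -E SF properxx.
rewrite cardsU1 nS card_imset; last exact: star_inj.
rewrite contract_mrank.
have -> : (1 + #|t| + rk M F == mrank M)%N = (#|t|.+1 == mrank M - rk M F)%N.
  by have := rk_le_mrank M F; clear; lia.
have -> : [forall T in S |: star SF @: t, flat M (val T)] =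
    [forall T in t, flat (contract M F) (val T)].
  apply/forall_inP/forall_inP => H T.
    by move=> Tt; rewrite -flat_star_set -(val_star SF); apply: H; rewrite inE imset_f ?orbT.
  rewrite !inE => /predU1P[->|/imsetP[T' T't ->]]; first by rewrite SF.
  by rewrite val_star flat_star_set H.
by case: (chainset t); case: (_ == _); rewrite /= ?andbT ?andbF.
Qed.

End LTruncation.

(** * The recursion *)

Lemma bigmax_nat_mem (s : seq nat) (P : pred nat) :
  (0 < \max_(i <- s | P i) i)%N ->
  (\max_(i <- s | P i) i \in s) && P (\max_(i <- s | P i) i).
Proof.
elim: s => [|i s IHs]; first by rewrite big_nil.
rewrite big_cons; case: ifP => Pi; last first.
  by move=> /IHs /andP[m_in Pm]; rewrite inE m_in orbT.
move: IHs; set m := \max_(i0 <- s | P i0) i0 => IHs.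
case: (leqP i m) => [le|lt _]; last by rewrite inE eqxx.
by move=> /IHs /andP[m_in Pm]; rewrite inE m_in orbT.
Qed.

Lemma sum_nat_last (a : nat -> nat) (k l m : nat) : (k <= l <= m)%N ->
  (forall i, k <= i <= m -> i != l -> a i = 0)%N -> (\sum_(k <= i < m.+1) a i = a l)%N.
Proof.
move=> /andP[kl lm] a0; rewrite (bigD1_seq l) ?iota_uniq ?mem_index_iota ?kl //=.
rewrite big_seq_cond big1 ?addn0 // => i /andP[]; rewrite mem_index_iota ltnS => /a0.
exact.
Qed.

Lemma actp_lform_exp (G : finType) (phi : psubset G -> rat) k
    (p : {mpoly rat[#|psubset G|]}) w : balanced w ->
  actp (lform phi ^+ k * p) w = iter k (act phi) (actp p w).
Proof.
move=> bw; elim: k => [|k IHk]; first by rewrite expr0 mul1r.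
by rewrite exprS -mulrA actp_lform // IHk.
Qed.

Section Recursion.
Variable G : finType.
Local Notation V := (psubset G).
Local Notation P := {mpoly rat[#|psubset G|]}.
Implicit Types (S : V) (w : {set V} -> rat) (t s : {set V}) (a b : nat -> nat) (M : matroid G).

(** Adjoining further sets keeps [S] as a member. This is applied to an [S] that is not a flat. *)
Lemma actp_vanish S (p : P) w : balanced w -> (forall t, S \in t -> w t = 0) ->
  forall t, S \in t -> actp p w t = 0.
Proof.
move=> bw w0; elim/mpoly_lin_ind: p => [|c m p IHp] t St; first by rewrite actp0.
rewrite actp_comb IHp // addr0 actpX.
suff -> : actm m w t = 0 by rewrite mulr0.
elim/mnm_addU_ind: m t St => [|i m IHm] t St; first by rewrite actm0 w0.
rewrite actmU // /actx /act big1 // => R _.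
by rewrite IHm ?mulr0 // inE St orbT.
Qed.

Definition Lmonom g a : P := \prod_(1 <= i < (pdim G).+1) Lpoly g i ^+ a i.

Lemma Lmonom_succ g a b k : (0 < k < (pdim G).+1)%N ->
  (forall i, b i = (a i + (i == k))%N) -> Lmonom g b = Lpoly g k * Lmonom g a.
Proof.
move=> bk bE; rewrite /Lmonom; under eq_bigr do rewrite bE exprD.
rewrite big_split /= mulrC; congr (_ * _).
rewrite (bigD1_seq k) ?iota_uniq ?mem_index_iota //= eqxx expr1 big1 ?mulr1 //.
by move=> i /negbTE->; rewrite expr0.
Qed.

(** As a function of [k], [min(k,s)] is linear except for a kink at [s], so its second difference at
    [k.+1] is minus the indicator of [s = k.+1]; the base point terms are linear in [k] and
    cancel. *)
Lemma Lfun_second_difference g k S :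
  Lfun g k S = 2%:R * Lfun g k.+1 S - Lfun g k.+2 S
    - \sum_(S0 : V) (#|val S0| == k.+1)%:R * delta S0 S.
Proof.
rewrite (bigD1 S) //= {1}/delta eqxx mulr1 big1 ?addr0 => [|T neT]; last first.
  by rewrite /delta [S == T]eq_sym (negbTE neT) mulr0.
set s := #|val S|.
have e : (minn k s + minn k.+2 s + (s == k.+1) = 2 * minn k.+1 s)%N.
  by case: eqP; lia.
have {}e : (minn k s)%:R = 2%:R * (minn k.+1 s)%:R - (minn k.+2 s)%:R - (s == k.+1)%:R :> rat.
  by rewrite -natrM -e !natrD; ring.
have k1 : k.+1%:R = k%:R + 1 :> rat by rewrite -natr1.
have k2 : k.+2%:R = k%:R + 2%:R :> rat by rewrite -natrD addn2.
rewrite /Lfun -/s e k1 k2; case: (g \in val S); ring.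
Qed.

Lemma act_Lfun_second_difference g k w s : balanced w ->
  act (Lfun g k) w s = 2%:R * act (Lfun g k.+1) w s - act (Lfun g k.+2) w s
    - \sum_(S : V | #|val S| == k.+1) act (delta S) w s.
Proof.
move=> bw; rewrite (eq_act _ (psi := fun S => 2%:R * Lfun g k.+1 S +
   (- 1 * Lfun g k.+2 S + (- 1 * (\sum_(S0 : V) (#|val S0| == k.+1)%:R * delta S0 S) + 0)))); last first.
  by move=> S; rewrite Lfun_second_difference !mulN1r addr0 !addrA.
rewrite !act_comb // act_bigsum // [act (fun=> 0) _ _](_ : _ = 0); last first.
  rewrite (actE (c := fun=> 0) bw); [|exact: big1|by move=> R _; apply: big1].
  by rewrite big1 // => R _; rewrite [linf _ _]big1 // subrr mul0r.
rewrite !mulN1r addr0 addrA; congr (_ - _); rewrite [RHS]big_mkcond; apply: eq_bigr => S _.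
by case: eqP; rewrite ?mul1r ?mul0r.
Qed.

(** The parameter [#|G|] belongs to index 0, where the minimum is [|S|] and the function is
    linear. *)
Lemma act_Lfun_full g w s : balanced w -> act (Lfun g #|G|) w s = 0.
Proof.
move=> bw; pose c e : rat := 1 - #|G|%:R * (e == g)%:R.
have cE (A : {set G}) : linf c A = #|A|%:R - #|G|%:R * (g \in A)%:R.
  by rewrite linfB linfZ linf1 /linf sumr_const.
rewrite -(act_lin s bw (c := c)); last by rewrite -linfT cE inE mulr1 cardsT subrr.
rewrite (@eq_act _ _ (fun S => linf c (val S))) // => S.
rewrite cE /Lfun (minn_idPr (max_card _)).
by case: (g \in val S); rewrite ?mulr1 ?mulr0.
Qed.

Lemma card_notin (F : {set G}) : #|{: {x : G | x \notin F}}| = (#|G| - #|F|)%N.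
Proof. by rewrite card_sig -(cardsC F) addKn; apply: eq_card => x; rewrite !inE. Qed.

Lemma res_Lmonom (F : {set G}) S (SF : val S = F) g g' a (r : seq nat) w : balanced w ->
  {in r, forall i, #|F| <= (pdim G).+1 - i}%N ->
  res SF (actp (\prod_(i <- r) Lpoly g i ^+ a i) w)
  = actp (\prod_(i <- r) Lpoly g' i ^+ a i) (res SF w).
Proof.
move=> bw rF; have bR := res_balanced SF bw.
have G'0 : (0 < #|{: {x : G | x \notin F}}|)%N by apply/card_gt0P; exists g'.
have cG' := card_notin F.
have G0 : (0 < #|G|)%N by apply/card_gt0P; exists g.
elim: r rF => [|i r IHr] rF.
  rewrite !big_nil; apply: funext => t; rewrite actp1 /res.
  by rewrite actp1.
rewrite !big_cons !actp_lform_exp //.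
rewrite -IHr; last by move=> k kr; apply: rF; rewrite inE kr orbT.
have := rF i (mem_head _ _).
(* Passing to the complement lowers the size of the ground set and the parameter [k] both by [#|F|],
   so the index [i] is unchanged. *)
have -> : ((pdim {x : G | x \notin F}).+1 - i = (pdim G).+1 - i - #|F|)%N.
  by rewrite /pdim !prednK // cG' subnAC.
move=> le; elim: (a i) => // k IHk; rewrite !iterS -IHk.
apply: res_Lfun => //; apply: balanced_iter; exact: balanced_actp.
Qed.

Lemma contract_loopless M F : flat M F -> loopless (contract M F).
Proof.
move=> /flatP fF; apply/forallP => x; rewrite /= /contract_rk imset_set1.
have := fF _ (valP x); have := rk_setU1_le M F (val x); rewrite setUC; lia.
Qed.

(** [L_1] has parameter [#|G| - 1], so it is the hyperplane class for the whole ground set; its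
    powers truncate [M] until the empty flag remains. *)
Lemma Lmonom_linear M g : loopless M ->
  actp (Lpoly g 1 ^+ (mrank M).-1) (wt M) set0 = 1.
Proof.
move=> lM; have bM := wt_balanced lM.
have -> : Lpoly g 1 ^+ (mrank M).-1 = Lpoly g 1 ^+ (mrank M).-1 * 1 by rewrite mulr1.
rewrite actp_lform_exp //.
have -> : actp 1 (wt M) = wt M by apply: funext => s; rewrite actp1.
rewrite -[set0]setU0.
have G0 : (0 < #|G|)%N by apply/card_gt0P; exists g.
have rM := mrank_gt0 lM G0.
have -> : ((pdim G).+1 - 1 = #|[set: G]|.-1)%N by rewrite subn1 cardsT.
have T0 : [set: G] != set0 by apply/set0Pn; exists g.
rewrite (truncation_wt lM T0 (flat_setT M)).
- have -> // : tcond M [set: G] set0 (mrank M).-1 set0.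
  apply/tcondP; split; rewrite ?setU0 ?cards0 ?add0n ?prednK //.
  + by apply/chainsetP => S T; rewrite inE.
  + by move=> S; rewrite inE.
  + by move=> S; rewrite inE.
- by move=> S; rewrite inE.
- by left.
- by move=> g1; apply: Lfun_truncation.
- by move=> S; rewrite inE.
Qed.

End Recursion.

Lemma actp0w (G : finType) (p : {mpoly rat[#|psubset G|]}) s : actp p (fun=> 0) s = 0.
Proof.
rewrite /actp big1 // => m _.
suff -> : actm m (fun=> 0) = (fun=> 0) :> ({set psubset G} -> rat) by rewrite mulr0.
rewrite /actm; elim: (enum _) => //= i l ->.
by elim: (m i) => //= k ->; apply: act0w.
Qed.

(** * The terms supported on stars, and the recursion *)

Section StarTerm.
Variable G : finType.
Local Notation V := (psubset G).
Local Notation P := {mpoly rat[#|psubset G|]}.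
Implicit Types (S : V) (w : {set V} -> rat) (t s : {set V}) (a b : nat -> nat) (M : matroid G).

Lemma Lmonom_split (g : G) a j : (1 < j < (pdim G).+1)%N -> a j.-1 = 0%N ->
  (forall i, j < i < (pdim G).+1 -> a i = 0)%N ->
  Lmonom g a = (\prod_(1 <= i < j.-1) Lpoly g i ^+ a i) * Lpoly g j ^+ a j.
Proof.
move=> /andP[j1 jm] a0 aj; rewrite /Lmonom (@big_cat_nat _ _ _ j.-1) /=; last 2 first.
- by move: j1; clear; lia.
- by move: jm; clear; lia.
congr (_ * _); rewrite (bigD1_seq j) ?iota_uniq ?mem_index_iota //=; last by move: j1 jm; clear; lia.
rewrite big_seq_cond big1 ?mulr1 // => i /andP[]; rewrite mem_index_iota => /andP[ji im] ij.
have [->|ne] := eqVneq i j.-1; first by rewrite a0 expr0.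
by rewrite aj ?expr0 //; move: ji im ij ne j1; clear; lia.
Qed.

Lemma actp_star M (F : {set G}) S (SF : val S = F) (g : G) (g' : {x : G | x \notin F}) a j (b : nat) :
  loopless M -> (1 < j < (pdim G).+1)%N -> #|F| = (pdim G - j + 2)%N -> flat M F ->
  actp ((\prod_(1 <= i < j.-1) Lpoly g i ^+ a i) * Lpoly g j ^+ b) (wt M) [set S] =
  (b.+1 == rk M F)%:R *
  actp (\prod_(1 <= i < j.-1) Lpoly g' i ^+ a i) (wt (contract M F)) set0.
Proof.
move=> lM /andP[j1 jm] cF fF; have bM := wt_balanced lM.
have -> : [set S] = S |: star SF @: set0 by rewrite imset0 setU0.
rewrite actpM // -/(res SF _ set0) (res_Lmonom SF g g'); first last.
- by move=> i; rewrite mem_index_iota cF; move: j1 jm; clear; lia.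
- exact: balanced_actp.
rewrite -[_ ^+ b]mulr1 actp_lform_exp //.
have -> : actp 1 (wt M) = wt M by apply: funext => s; rewrite actp1.
(* The size of [F] is exactly such that [L_j] becomes the hyperplane class of [F]. *)
have -> : ((pdim G).+1 - j = #|F|.-1)%N by rewrite cF; move: j1 jm; clear; lia.
rewrite res_truncation //; case: eqP => _ /=.
  by rewrite mul1r; congr (actp _ _ _); apply: funext => t; rewrite mul1r.
rewrite mul0r; apply: etrans (actp0w _ _).
by congr (actp _ _ _); apply: funext => t; rewrite mul0r.
Qed.

(** The complement of [F] has [j - 1] elements, so the classes there are [L_1] to [L_{j-2}]. Their
    exponents add up to the rank of the contraction minus one only if [b] is the rank of [F];
    otherwise both sides vanish. *)
Lemma actp_star_mixed M (F : {set G}) S (SF : val S = F) (g : G) a j (b : nat) :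
  loopless M -> (1 < j < (pdim G).+1)%N -> #|F| = (pdim G - j + 2)%N -> flat M F ->
  (\sum_(1 <= i < j.-1) a i + b = (mrank M).-1)%N -> (0 < b)%N ->
  actp ((\prod_(1 <= i < j.-1) Lpoly g i ^+ a i) * Lpoly g j ^+ b.-1) (wt M) [set S] =
  (b == rk M F)%:R * mixed_eulerian (contract M F) a.
Proof.
move=> lM jm cF fF sa b0.
have G0 : (0 < #|G|)%N by apply/card_gt0P; exists g.
have cG' : #|{: {x : G | x \notin F}}| = j.-1.
  by rewrite card_notin cF; move: jm G0; rewrite /pdim; clear; lia.
have G'0 : (0 < #|{: {x : G | x \notin F}}|)%N by rewrite cG'; move: jm; clear; lia.
have [g' g'P] := mixed_eulerianE G'0.
have pG' : (pdim {x : G | x \notin F}).+1 = j.-1 by rewrite /pdim prednK.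
rewrite (actp_star SF g g') // prednK //; case: eqP => [rF|]; last by rewrite !mul0r.
rewrite g'P ?pG' //; first exact: contract_loopless.
by rewrite contract_mrank -rF; move: sa; clear; lia.
Qed.

Lemma sum_psubset (F : {set G} -> rat) (Q : pred {set G}) :
  (forall A, Q A -> 0 < #|A| < #|G|)%N ->
  \sum_(A | Q A) F A = \sum_(S : V | Q (val S)) F (val S).
Proof.
move=> QP; rewrite (reindex_omap (val : V -> {set G}) insub); last first.
  move=> A /QP /andP[A0 AG]; rewrite insubT //=.
  by rewrite -card_gt0 A0 properEcard subsetT cardsT.
by apply: eq_bigl => S; rewrite valK eqxx andbT.
Qed.

(** One factor [L_j] is replaced by means of the second difference; [b] holds the remaining
    exponents, and [v] is their monomial applied to the weight of [M]. *)
Lemma mixed_eulerian_rec M (g : G) a j : loopless M -> (1 < j < (pdim G).+1)%N -> (0 < a j)%N ->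
  (forall i, j < i < (pdim G).+1 -> a i = 0)%N ->
  (\sum_(1 <= i < (pdim G).+1) a i = (mrank M).-1)%N ->
  actp (Lmonom g a) (wt M) set0 =
   - (if j == 2%N then 0 else actp (Lmonom g
               (fun i => if i == (j - 2)%N then (a i).+1
                         else if i == j then (a i - 1)%N else a i)) (wt M) set0)
     + 2%:R * actp (Lmonom g
               (fun i => if i == (j - 1)%N then (a i).+1
                         else if i == j then (a i - 1)%N else a i)) (wt M) set0
     - (if a (j - 1)%N == 0%N then
          \sum_(F : {set G} |
                [&& flat M F, #|F| == (pdim G - j + 2)%N
                  & rk M F == (\sum_((j - 1)%N <= i < (pdim G).+1) a i)%N])
            mixed_eulerian (contract M F) a
        else 0).
Proof.
move=> lM /andP[j1 jm] aj az sa; have bM := wt_balanced lM.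
have G0 : (0 < #|G|)%N by apply/card_gt0P; exists g.
pose b (i : nat) := if i == j then (a i - 1)%N else a i.
set v := actp (Lmonom g b) (wt M).
have bv : balanced v by apply: balanced_actp.
have succE k a' : (0 < k < (pdim G).+1)%N -> (forall i, a' i = (b i + (i == k))%N) ->
    actp (Lmonom g a') (wt M) set0 = act (Lfun g ((pdim G).+1 - k)) v set0.
  by move=> kj a'E; rewrite (Lmonom_succ g (a := b) (k := k)) // actp_lform.
set k := ((pdim G).+1 - j)%N.
rewrite (succE j); last 2 first.
- by rewrite jm (ltnW j1).
- by move=> i; rewrite /b; case: eqP => [->|_]; rewrite ?addn0 // subn1 addn1 prednK.
rewrite -/k act_Lfun_second_difference // [2%:R * _ - _]addrC.
congr (_ + _ - _).
- congr (- _); have [j2|j2] := eqVneq j 2%N.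
    (* For [j = 2] the class with index 0 would appear, and it acts by zero. *)
    rewrite (_ : k.+2 = #|G|) ?act_Lfun_full // /k j2.
    by move: jm; rewrite j2 /pdim; move: G0; clear; lia.
  rewrite (succE (j - 2)%N); last 2 first.
  + by move: j1 j2 jm; clear; lia.
  + by move=> i; rewrite /b; case: (eqVneq i (j - 2)%N) => [->|_]; rewrite ?addn0 // addn1 ifN //;
    move: j1 j2; clear; lia.
  by congr (act (Lfun g _) v _); rewrite /k; move: j1 j2 jm; clear; lia.
- congr (_ * _); rewrite (succE (j - 1)%N); last 2 first.
  + by move: j1 jm; clear; lia.
  + by move=> i; rewrite /b; case: (eqVneq i (j - 1)%N) => [->|_]; rewrite ?addn0 // addn1 ifN //;
    move: j1; clear; lia.
  by congr (act (Lfun g _) v _); rewrite /k; move: j1 jm; clear; lia.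
have kE : k.+1 = (pdim G - j + 2)%N by rewrite /k; move: jm; clear; lia.
transitivity (\sum_(S : V | #|val S| == (pdim G - j + 2)%N) v [set S]).
  by rewrite kE; apply: eq_bigr => S _; rewrite act_delta ?setU0 ?inE.
have [a0|a0] := eqVneq (a (j - 1)%N) 0%N; last first.
  (* A factor [L_{j-1}] is left in [v]; its parameter is the size of [S], so it vanishes on the
     star. *)
  rewrite big1 // => S /eqP cS.
  pose b' (i : nat) := if i == (j - 1)%N then (b i - 1)%N else b i.
  rewrite /v (Lmonom_succ g (a := b') (k := (j - 1)%N)); last 2 first.
  - by move: j1 jm; clear; lia.
  - move=> i; rewrite /b' /b; case: (eqVneq i (j - 1)%N) => [->|_]; last by rewrite addn0.
    rewrite ifN; last by move: j1; clear; lia.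
    by move: a0; clear; lia.
  rewrite actp_lform // (_ : ((pdim G).+1 - (j - 1) = #|val S|)%N).
    by apply: act_Lfun_card; rewrite ?inE //; apply: balanced_actp.
  by rewrite cS; move: j1 jm; clear; lia.
have rE : (\sum_((j - 1)%N <= i < (pdim G).+1) a i = a j)%N.
  apply: sum_nat_last; first by move: jm; clear; lia.
  move=> i /andP[ji im] ij; have [->//|ne] := eqVneq i (j - 1)%N.
  by apply: az; move: ji im ij ne j1; clear; lia.
rewrite rE sum_psubset; last first.
  move=> A /and3P[_ /eqP-> _]; move: j1 jm G0; rewrite /pdim; clear; lia.
rewrite (bigID (fun S : V => flat M (val S) && (rk M (val S) == a j))) /=.
have split0 : Lmonom g b = (\prod_(1 <= i < j.-1) Lpoly g i ^+ b i) * Lpoly g j ^+ b j.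
  apply: Lmonom_split; first by rewrite j1.
    by rewrite /b -subn1 a0; case: eqP.
  by move=> i /andP[ji im]; rewrite /b az ?ji //; case: eqP.
have eqb : \prod_(1 <= i < j.-1) Lpoly g i ^+ b i = \prod_(1 <= i < j.-1) Lpoly g i ^+ a i.
  apply: eq_big_nat => i /andP[_ ij]; rewrite /b ifN //.
  by move: ij; clear; lia.
have sa' : (\sum_(1 <= i < j.-1) a i + a j = (mrank M).-1)%N.
  rewrite -sa (@big_cat_nat _ _ _ j.-1 1 (pdim G).+1) /=; last 2 first.
  - by move: j1; clear; lia.
  - by move: jm; clear; lia.
  by rewrite -subn1 rE.
have starE (S : V) : #|val S| = (pdim G - j + 2)%N -> flat M (val S) ->
    v [set S] = (a j == rk M (val S))%:R * mixed_eulerian (contract M (val S)) a.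
  move=> cS fS; rewrite /v split0 eqb /b eqxx subn1.
  by rewrite (actp_star_mixed (erefl (val S))) ?j1.
(* A set that is not a flat lies in no flag of flats, and on a flat of rank other than [a j] the
   power of [L_j] vanishes. *)
rewrite [X in _ + X]big1 ?addr0 => [|S /andP[/eqP cS nS]]; last first.
  have [fS|nfS] := boolP (flat M (val S)); last first.
    apply: (actp_vanish (S := S) _ bM); last by rewrite inE.
    move=> t St; rewrite /wt (_ : [forall S in t, flat M (val S)] = false) ?andbF //.
    by apply/negP => /forall_inP/(_ S St); apply/negP.
  by rewrite starE // (_ : _ == _ = false) ?mul0r //; move: nS; rewrite fS eq_sym => /negbTE.
apply: eq_big => [S|S /andP[/eqP cS /andP[fS /eqP rS]]].
  by rewrite andbCA.
by rewrite starE // rS eqxx mul1r.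
Qed.

End StarTerm.

Theorem theorem1p10 (n r : nat) (M : matroid 'I_n.+1) (a : nat -> nat) (j : nat)
    (hr : (1 <= r)%N)
    (hloopless : loopless M)
    (hrank : mrank M = r.+1)
    (ha : (\sum_(1 <= i < n.+1) a i)%N = r)
    (hj : j = (\max_(1 <= i < n.+1 | (0 < a i)%N) i)%N) :
  (j = 1%N -> mixed_eulerian M a = 1) /\
  ((1 < j)%N ->
   mixed_eulerian M a =
     - (if j == 2%N then 0
        else mixed_eulerian M
               (fun i => if i == (j - 2)%N then (a i).+1
                         else if i == j then (a i - 1)%N else a i))
     + 2%:R * mixed_eulerian M
               (fun i => if i == (j - 1)%N then (a i).+1
                         else if i == j then (a i - 1)%N else a i)
     - (if a (j - 1)%N == 0%N then
          \sum_(F : {set 'I_n.+1} |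
                [&& flat M F, #|F| == (n - j + 2)%N
                  & rk M F == (\sum_((j - 1)%N <= i < n.+1) a i)%N])
            mixed_eulerian (contract M F) a
        else 0)).
Proof.
have pn : pdim 'I_n.+1 = n by rewrite /pdim card_ord.
have G0 : (0 < #|'I_n.+1|)%N by rewrite card_ord.
have [g gP] := mixed_eulerianE G0.
have jmax i : (0 < i < n.+1)%N -> (0 < a i)%N -> (i <= j)%N.
  by move=> im ai; rewrite hj; apply: (leq_bigmax_seq (F := id)); rewrite ?mem_index_iota.
have az i : (j < i < n.+1)%N -> a i = 0%N.
  move=> /andP[ji im]; apply/eqP; rewrite -leqn0 leqNgt; apply/negP => ai.
  by have := jmax i; rewrite im ai (leq_ltn_trans _ ji) // leqNgt ji => /(_ isT isT).
have jP : (0 < j)%N -> (0 < j < n.+1)%N && (0 < a j)%N.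
  move=> j0; have := @bigmax_nat_mem (index_iota 1 n.+1) (fun i => 0 < a i)%N.
  by rewrite -hj mem_index_iota => /(_ j0).
have sumE a' : (\sum_(1 <= i < n.+1) a' i)%N = r ->
    mixed_eulerian M a' = actp (Lmonom g a') (wt M) set0.
  by move=> sa'; rewrite gP // pn sa' hrank.
split=> [j1|j1].
  have := jP; rewrite j1 => /(_ isT)/andP[/andP[_ n1] a1].
  have a1r : a 1%N = r.
    rewrite -ha; apply/esym/sum_nat_last; first by rewrite ltnS in n1.
    by move=> i /andP[i1 im] ni; apply: az; rewrite j1 ltn_neqAle eq_sym ni i1 ltnS.
  rewrite sumE // /Lmonom pn (bigD1_seq 1%N) ?iota_uniq ?mem_index_iota //=.
  rewrite big_seq_cond big1 ?mulr1 => [|i]; last first.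
    rewrite mem_index_iota => /andP[/andP[i1 im] ni].
    by rewrite az ?expr0 // j1 ltn_neqAle eq_sym ni i1.
  by rewrite a1r; have := Lmonom_linear g hloopless; rewrite hrank.
have /andP[/andP[j0 jn] aj] := jP (ltnW j1).
(* The passage from mixed Eulerian numbers to the action requires exponents of total [r]. Both
   shifted vectors add one unit to [b], whose total is [r - 1]. *)
pose b (i : nat) := if i == j then (a i - 1)%N else a i.
have sb : (\sum_(1 <= i < n.+1) b i).+1 = r.
  rewrite -ha (bigD1_seq j) ?iota_uniq ?mem_index_iota ?j0 //=.
  rewrite [in RHS](bigD1_seq j) ?iota_uniq ?mem_index_iota ?j0 //= /b eqxx.
  rewrite -addSn subn1 prednK //; congr (_ + _)%N.
  by apply: eq_bigr => i /negbTE->.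
have sumb k a' : (0 < k < n.+1)%N -> (forall i, a' i = (b i + (i == k))%N) ->
    (\sum_(1 <= i < n.+1) a' i)%N = r.
  move=> kn a'E; rewrite (eq_bigr _ (fun i _ => a'E i)) big_split /= -sb -[RHS]addn1; congr (_ + _)%N.
  rewrite (@sum_nat_last _ _ k) ?eqxx // => i _ /negbTE-> //.
have jn2 : (0 < j - 1 < n.+1)%N by move: j1 jn; clear; lia.
rewrite [LHS]sumE // (mixed_eulerian_rec g hloopless (j := j)) ?pn ?j1 ?hrank //.
congr (- _ + _ * _ - _).
- case: ifPn => // j2; rewrite sumE // (sumb (j - 2)%N) //.
    by move: j1 j2 jn; clear; lia.
  move=> i; rewrite /b; case: (eqVneq i (j - 2)%N) => [->|_]; rewrite ?addn0 // addn1 ifN //.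
  by move: j1 j2; clear; lia.
- rewrite sumE // (sumb (j - 1)%N) // => i.
  rewrite /b; case: (eqVneq i (j - 1)%N) => [->|_]; rewrite ?addn0 // addn1 ifN //.
  by move: j1; clear; lia.
Qed.
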